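(* Let $(R,\mathfrak m)$ be a Cohen-Macaulay local ring of dimension $d\ge1$ with infinite residue field. Let $I_1,I_2$ be $\mathfrak m$-primary ideals and let $(x_1,\dots,x_d)$ be a minimal reduction of $I_2$ generated by a superficial sequence $x_1,\dots,x_d$ for $I_2$ and $I_1$. Let $1\le i\le d$, and put $K_i=R$ if $1\le i\le d-1$ and $K_d=I_1$. Then $$g_{i}=\sum_{n\ge i-1}\binom{n}{i-1}\left[\ell\!\left(\frac{I_1I_2^{n+1}+(x_1,\dots,x_d)}{(x_1,\dots,x_d)}\right)-\sum_{j\ge1}(-1)^jh_j(1,n+1)\right]+(-1)^d\ell\!\left(\frac R{K_i}\right)$$ and $$g_{i}=\sum_{n\ge i-1}\binom{n}{i-1}\left[\ell\!\left(\frac{I_1I_2^{n+1}}{(x_1,\dots,x_d)I_1I_2^{n}}\right)-\sum_{j\ge2}(-1)^jh_j(1,n+1)\right]+(-1)^d\ell\!\left(\frac R{K_i}\right).$$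
   Context: $\ell$ denotes length. Convention: $I^n=R$ for $n\le 0$. The integers $g_j=g_{j,I_1}(I_2)$, $0\le j\le d$, are defined by $$\ell(R/I_1I_2^n)=\sum_{j=0}^d(-1)^jg_j\binom{n+d-j-1}{d-j}\quad\text{for } n\gg0.$$ For $n\in\mathbb Z$, let $C(1,n)$ be the complex whose degree $i$ term ($0\le i\le d$) is $(R/I_1I_2^{n-i})^{\binom di}$ and whose differentials are induced by those of the Koszul complex $K_\bullet(x_1,\dots,x_d;R)$. Put $h_i(1,n):=\ell(H_i(C(1,n)))$. An element $x\in I_2$ is superficial for $I_2$ and $I_1$ if there is a positive integer $r_0$ such that $xR\cap I_1^sI_2^r=xI_1^sI_2^{r-1}$ for all $r\ge r_0$ and all $s\ge0$. A sequence $x_1,\dots,x_d$ in $I_2$ is a superficial sequence for $I_2$ and $I_1$ if for each $i$ the image of $x_i$ in $R/(x_1,\dots,x_{i-1})$ is superficial for the images of $I_2$ and $I_1$. *)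

(* Defs.v *)
From HB Require Import structures.
From mathcomp Require Import all_boot all_order all_algebra.
From mathcomp Require Import boolp classical_sets functions cardinality.

Set Implicit Arguments.
Unset Strict Implicit.
Unset Printing Implicit Defensive.

Import GRing.Theory.
Local Open Scope classical_set_scope.
Local Open Scope ring_scope.
Local Open Scope quotient_scope.

Section Submodules.
Variables (R : comPzRingType) (V : lmodType R).
Implicit Types A B : set V.

Definition is_submod A : Prop := GRing.submod_closed (mem A : {pred V}).

Definition mspan A : set V := smallest is_submod A.

Lemma mspan_is_submod A : is_submod (mspan A).
Proof.
split; first by apply/mem_set => B [[/set_mem B0 _] _].
move=> a u v /set_mem uA /set_mem vA; apply/mem_set => B [sB AB].
by apply/set_mem/(sB.2 a); apply/mem_set; [apply: uA | apply: vA].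
Qed.

Definition mspan_pred A : {pred V} := [pred v | v \in mspan A].

Lemma mspan_pred_closed A : GRing.submod_closed (mspan_pred A).
Proof. exact: mspan_is_submod. Qed.

HB.instance Definition _ A :=
  GRing.isSubmodClosed.Build R V (mspan_pred A)
    (GRing.submod_closed_semi (mspan_pred_closed A)).
HB.instance Definition _ A :=
  GRing.isZmodClosed.Build V (mspan_pred A)
    (GRing.submod_closedB (mspan_pred_closed A)).

(* A strictly increasing chain of n + 1 submodules from B up to A; these
   correspond to the chains of submodules of A / B from 0 to A / B. *)
Definition submod_chain A B (n : nat) (M : nat -> set V) : Prop :=
  [/\ M 0%N = B, M n = A,
      forall i, (i <= n)%N -> is_submod (M i)
    & forall i, (i < n)%N -> M i `<` M i.+1].

Definition is_length A B (n : nat) : Prop :=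
  (exists M, submod_chain A B n M) /\
  (forall k M, submod_chain A B k M -> (k <= n)%N).

(* The length of A / B for submodules B of A; it is 0 by convention when A / B
   does not have finite length. *)
Definition mlength A B : nat := xget 0%N [set n | is_length A B n].

(* V / A, for a submodule A (in general, V modulo the span of A). *)
Definition qmod A := @Quotient.quot V (mspan_pred A).

HB.instance Definition _ A := GRing.Zmodule.on (qmod A).
HB.instance Definition _ A := EqQuotient.on (qmod A).
HB.instance Definition _ A :=
  @isZmodQuotient.Build V (Quotient.equiv (mspan_pred A)) 0 -%R +%R (qmod A)
    (lock _) (@Quotient.pi_opp V (mspan_pred A)) (@Quotient.pi_add V (mspan_pred A)).

Lemma qmod_eqP A (u v : V) :
  reflect (u = v %[mod qmod A]) (u - v \in mspan_pred A).
Proof. by rewrite (Quotient.idealrBE (mspan_pred A)); apply: eqP. Qed.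

Definition qscale A (a : R) (u : qmod A) : qmod A := \pi_(qmod A) (a *: repr u).

Lemma pi_qscale A a (v : V) : qscale a (\pi_(qmod A) v) = \pi_(qmod A) (a *: v).
Proof.
apply/qmod_eqP; rewrite -scalerBr rpredZ //; apply/qmod_eqP.
exact: reprK.
Qed.

Lemma qscaleA A a b (u : qmod A) : qscale a (qscale b u) = qscale (a * b) u.
Proof. by rewrite -[u]reprK (pi_qscale _ b) !pi_qscale scalerA. Qed.

Lemma qscale1 A : left_id 1 (@qscale A).
Proof. by move=> u; rewrite -[u]reprK pi_qscale scale1r. Qed.

Lemma qscaleDr A : right_distributive (@qscale A) +%R.
Proof.
move=> a u v; rewrite -[u]reprK -[v]reprK !pi_qscale.
by rewrite -!raddfD /= pi_qscale scalerDr.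
Qed.

Lemma qscaleDl A (u : qmod A) : {morph (@qscale A)^~ u : a b / a + b}.
Proof. by move=> a b; rewrite -[u]reprK !pi_qscale scalerDl raddfD. Qed.

HB.instance Definition _ A :=
  GRing.Zmodule_isLmodule.Build R (qmod A)
    (@qscaleA A) (@qscale1 A) (@qscaleDr A) (@qscaleDl A).

End Submodules.

Section QuotientRing.
Variables (R : comPzRingType) (J : set R).

(* The quotient ring R / J; J is seen as a subset of the R-module R^o. *)
Definition qring := @qmod R R^o J.

HB.instance Definition _ := GRing.Zmodule.on qring.

Definition qpi (a : R) : qring := \pi_(@qmod R R^o J) a.
Definition qone : qring := qpi 1.
Definition qmul (u v : qring) : qring := qpi (repr u * repr v).

Lemma qpiK (u : qring) : qpi (repr u) = u.
Proof. exact: reprK. Qed.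

Lemma qpiM a b : qmul (qpi a) (qpi b) = qpi (a * b).
Proof.
have E (c : R) : (repr (qpi c) - c : R^o) \in mspan_pred (J : set R^o).
  by apply/qmod_eqP; exact: reprK.
apply/qmod_eqP; set a' := repr _; set b' := repr _.
have -> : (a' * b' - a * b : R^o) = a' *: (b' - b : R^o) + b *: (a' - a : R^o).
  rewrite /GRing.scale /= !mulrBr [b * a']mulrC [b * a]mulrC.
  by rewrite addrA subrK.
by apply: rpredD; apply: rpredZ; apply: E.
Qed.

Lemma qpiD a b : qpi (a + b) = qpi a + qpi b.
Proof. exact: (raddfD \pi_(@qmod R R^o J)). Qed.

Lemma qmulA : associative qmul.
Proof.
by move=> u v w; rewrite -[u]qpiK -[v]qpiK -[w]qpiK !qpiM mulrA.
Qed.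

Lemma qmulC : commutative qmul.
Proof. by move=> u v; rewrite -[u]qpiK -[v]qpiK !qpiM mulrC. Qed.

Lemma qmul1 : left_id qone qmul.
Proof. by move=> u; rewrite -[u]qpiK qpiM mul1r. Qed.

Lemma qmulDl : left_distributive qmul +%R.
Proof.
by move=> u v w; rewrite -[u]qpiK -[v]qpiK -[w]qpiK -qpiD !qpiM mulrDl qpiD.
Qed.

HB.instance Definition _ :=
  GRing.Zmodule_isComPzRing.Build qring qmulA qmulC qmul1 qmulDl.

End QuotientRing.

Section Ideals.
Variable R : comPzRingType.
Implicit Types I J A B m : set R.

Definition is_ideal I : Prop := @is_submod R R^o I.

Definition ideal_gen A : set R := @mspan R R^o A.

Definition addI I J : set R := [set a + b | a in I & b in J].

Definition mulI I J : set R := ideal_gen [set a * b | a in I & b in J].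

Definition expI I (n : nat) : set R := iter n (mulI I) setT.

(* I^n = R for n <= 0. *)
Definition expIz I (n : int) : set R := if n is Posz k then expI I k else setT.

Definition lenI I J : nat := @mlength R R^o I J.

Definition is_prime (p : set R) : Prop :=
  [/\ is_ideal p, p <> setT & forall a b, p (a * b) -> p a \/ p b].

Definition is_maximal m : Prop :=
  [/\ is_ideal m, m <> setT
    & forall J, is_ideal J -> m `<=` J -> J = m \/ J = setT].

Definition radical I : set R := [set a | exists n, I (a ^+ n)].

Definition is_primary I : Prop :=
  [/\ is_ideal I, I <> setT
    & forall a b, I (a * b) -> I a \/ radical I b].

Definition primary_to m I : Prop := is_primary I /\ radical I = m.

Definition noetherian : Prop :=
  forall I, is_ideal I -> exists s : seq R, I = ideal_gen [set` s].

Definition local_ring m : Prop :=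
  is_maximal m /\ (forall m', is_maximal m' -> m' = m).

Definition prime_chain (n : nat) (p : nat -> set R) : Prop :=
  (forall i, (i <= n)%N -> is_prime (p i)) /\
  (forall i, (i < n)%N -> p i `<` p i.+1).

Definition krull_dim (d : nat) : Prop :=
  (exists p, prime_chain d p) /\ (forall n p, prime_chain n p -> (n <= d)%N).

Definition prefix_ideal (d : nat) (x : 'I_d -> R) (k : nat) : set R :=
  ideal_gen [set x j | j in [set j : 'I_d | (j < k)%N]].

Definition regular_seq (k : nat) (a : 'I_k -> R) : Prop :=
  (forall i : 'I_k,
      injective (fun u : qring (prefix_ideal a i) => qpi _ (a i) * u)) /\
  prefix_ideal a k <> setT.

Definition depth m (d : nat) : Prop :=
  (exists a : 'I_d -> R, (forall i, m (a i)) /\ regular_seq a) /\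
  (forall k (a : 'I_k -> R),
      (forall i, m (a i)) -> regular_seq a -> (k <= d)%N).

Definition cohen_macaulay_local m : Prop :=
  [/\ noetherian, local_ring m & exists k, krull_dim k /\ depth m k].

Definition is_reduction J I : Prop :=
  [/\ is_ideal J, J `<=` I & exists n, expI I n.+1 = mulI J (expI I n)].

Definition is_minimal_reduction J I : Prop :=
  is_reduction J I /\
  (forall J', is_reduction J' I -> J' `<=` J -> J' = J).

Definition superficial (I2 I1 : set R) (x : R) : Prop :=
  I2 x /\
  exists2 r0 : nat, (0 < r0)%N &
    forall r s : nat, (r0 <= r)%N ->
      ideal_gen [set x] `&` mulI (expI I1 s) (expI I2 r) =
      [set x * y | y in mulI (expI I1 s) (expI I2 r.-1)].

End Ideals.

Definition superficial_seq (R : comPzRingType) (I2 I1 : set R) (d : nat)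
    (x : 'I_d -> R) : Prop :=
  (forall i, I2 (x i)) /\
  (forall i : 'I_d, let pi := qpi (prefix_ideal x i) in
      superficial (pi @` I2) (pi @` I1) (pi (x i))).

Section Koszul.
Variables (R : comPzRingType) (d : nat) (x : 'I_d -> R).

(* The basis e_S, with S an i-element subset of {0, ..., d-1}, of the degree i
   term of the Koszul complex. *)
Definition kbasis (i : nat) := {S : {set 'I_d} | #|S| == i}.

(* e_S is sent to \sum_(j in S) (-1)^#{k in S | k < j} x_j e_(S \ j); in degree
   0 this is the zero map. *)
Definition koszul_diff (i : nat) (c : {ffun kbasis i -> R}) :
    {ffun kbasis i.-1 -> R} :=
  [ffun T => \sum_(S : kbasis i)
     \sum_(j in val S | (val S :\ j)%SET == val T)
       (-1) ^+ #|[set k in val S | (k < j)%N]%SET| * x j * c S].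

Variables I1 I2 : set R.

Definition cpx_ideal (n : int) : set R^o := mulI I1 (expIz I2 n).
Definition cpx_term (n : int) (i : nat) : lmodType R :=
  {ffun kbasis i -> qmod (cpx_ideal (n - i%:Z))}.

(* The Koszul differential computed on representatives; when the x j lie in I2
   it does not depend on them. *)
Definition cpx_diff (n : int) (i : nat) (c : cpx_term n i) :
    cpx_term n i.-1 :=
  [ffun T => \pi_(qmod (cpx_ideal (n - i.-1%:Z)))
     (koszul_diff [ffun S => repr (c S)] T)].

Definition cpx_h (n : int) (i : nat) : nat :=
  mlength [set c : cpx_term n i | cpx_diff c = 0]
         (range (@cpx_diff n i.+1)).

End Koszul.

(* Only g 0, ..., g d are constrained; the truncated subtractions are exact as
   soon as n >= 1. *)
Definition hilbert_coeffs (R : comPzRingType) (I1 I2 : set R) (d : nat)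
    (g : nat -> int) : Prop :=
  exists N : nat, forall n : nat, (N <= n)%N ->
    (lenI setT (mulI I1 (expI I2 n)))%:Z =
    \sum_(0 <= j < d.+1) (-1) ^+ j * g j * 'C(n + d - j - 1, d - j)%:Z.

(* s is the sum of f n over n >= k, all but finitely many f n being zero. *)
Definition sums_to (k : nat) (f : nat -> int) (s : int) : Prop :=
  exists N : nat, (forall n, (N <= n)%N -> f n = 0) /\
                  s = \sum_(k <= n < N) f n.

(* Main.v *)
From HB Require Import structures.
Require Import Defs.
From mathcomp Require Import all_boot all_order all_algebra.
From mathcomp Require Import ring.
From mathcomp Require Import boolp classical_sets functions cardinality.

(** Write H(n) for the length of R / I1 I2^n, P for its polynomial and
    (D f)(n) = f(n) - f(n - 1) on functions of n in Z. The Euler characteristic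
    of C(1, n) gives D^d H (n) = sum_j (-1)^j h_j(1, n), with
    h_0(1, n) = l(R / (X + I1 I2^n)), whereas D^d P = g_0. Once g_0 = l(R / X) is
    known, D^d (P - H)(n) is therefore the bracket of the first formula; as P - H
    vanishes for n >> 0, summation by parts turns the weighted sum into
    (-1)^i D^(d-i) (P - H)(0), and D^(d-i) P (0) = (-1)^i g_i while H is constant
    on n <= 0. The second formula follows from
    h_1(1, n+1) = l(X cap I1 I2^(n+1) / X I1 I2^n), a consequence of the vanishing
    of H_1(x; R).

    Cohen-Macaulayness enters through this vanishing: if y_1, ..., y_d in m is
    regular, then multiplication by y_k is injective on H_i(x; R/(y_1..y_(k-1)))
    as soon as H_(i+1)(x; R/(y_1..y_k)) = 0, and it is nilpotent because some power
    of y_k lies in X. Nakayama's lemma then makes x_1, ..., x_d regular, and for a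
    regular superficial sequence each x_k lowers the Hilbert function to its
    difference, whence g_0 = D^d H (n) = l(R / X) for n >> 0. *)

Set Implicit Arguments.
Unset Strict Implicit.
Unset Printing Implicit Defensive.

Import GRing.Theory.
Local Open Scope classical_set_scope.
Local Open Scope ring_scope.

(** * Length of subquotients *)

Section Submodules.
Variables (R : comPzRingType) (V : lmodType R).
Implicit Types (A B C N : set V).

Lemma submodP A : is_submod A <->
  A 0 /\ (forall a u v, A u -> A v -> A (a *: u + v)).
Proof.
split=> [[A0 sA]|[A0 sA]].
  split; first exact/set_mem/A0.
  by move=> a u v uA vA; apply/set_mem/(sA a); apply/mem_set.
split; first exact/mem_set.
by move=> a u v /set_mem uA /set_mem vA; apply/mem_set/sA.
Qed.

Lemma submod0 A : is_submod A -> A 0.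
Proof. by case/submodP. Qed.

Lemma submodZD A a u v : is_submod A -> A u -> A v -> A (a *: u + v).
Proof. by case/submodP=> _; apply. Qed.

Lemma submodD A u v : is_submod A -> A u -> A v -> A (u + v).
Proof. by move=> sA uA vA; rewrite -[u]scale1r; apply: submodZD. Qed.

Lemma submodZ A a u : is_submod A -> A u -> A (a *: u).
Proof.
by move=> sA uA; rewrite -[_ *: _]addr0; apply: submodZD => //; apply: submod0.
Qed.

Lemma submodN A u : is_submod A -> A u -> A (- u).
Proof. by move=> sA uA; rewrite -scaleN1r; apply: submodZ. Qed.

Lemma submodB A u v : is_submod A -> A u -> A v -> A (u - v).
Proof. by move=> sA uA vA; apply: submodD => //; apply: submodN. Qed.

Lemma submod_sum A (I : Type) (r : seq I) (P : pred I) (F : I -> V) :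
  is_submod A -> (forall i, P i -> A (F i)) -> A (\sum_(i <- r | P i) F i).
Proof.
by move=> sA FA; elim/big_ind: _ => //; [apply: submod0 | move=> *; apply: submodD].
Qed.

Lemma submodT : is_submod [set: V].
Proof. exact/submodP. Qed.

Lemma submodI A B : is_submod A -> is_submod B -> is_submod (A `&` B).
Proof.
move=> sA sB; apply/submodP; split; first by split; apply: submod0.
by move=> a u v [uA uB] [vA vB]; split; apply: submodZD.
Qed.

Definition addS A B : set V := [set a + b | a in A & b in B].

Lemma addSP A B v : addS A B v <-> exists a b, [/\ A a, B b & v = a + b].
Proof.
split=> [[a aA [b bB <-]]|[a [b [aA bB ->]]]]; first by exists a, b.
by exists a => //; exists b.
Qed.

Lemma submod_addS A B : is_submod A -> is_submod B -> is_submod (addS A B).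
Proof.
move=> sA sB; apply/submodP; split.
  by apply/addSP; exists 0, 0; rewrite addr0; split=> //; apply: submod0.
move=> a _ _ /addSP[u [v [uA vB ->]]] /addSP[u' [v' [uA' vB' ->]]].
apply/addSP; exists (a *: u + u'), (a *: v + v').
by split; try exact: submodZD; rewrite scalerDr addrACA.
Qed.

Lemma sub_addSl A B : is_submod B -> A `<=` addS A B.
Proof.
by move=> sB a aA; apply/addSP; exists a, 0; rewrite addr0; split=> //; apply: submod0.
Qed.

Lemma sub_addSr A B : is_submod A -> B `<=` addS A B.
Proof.
by move=> sA b bB; apply/addSP; exists 0, b; rewrite add0r; split=> //; apply: submod0.
Qed.

Lemma addS_min A B C : is_submod C -> A `<=` C -> B `<=` C -> addS A B `<=` C.
Proof.
by move=> sC AC BC _ /addSP[a [b [/AC aC /BC bC ->]]]; apply: submodD.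
Qed.

Lemma addS_absorb A B : is_submod A -> is_submod B -> B `<=` A -> addS A B = A.
Proof.
move=> sA sB BA; apply/seteqP; split; first exact: addS_min.
exact: sub_addSl.
Qed.

Lemma sub_mspan A : A `<=` mspan A.
Proof. by move=> v vA B [_ AB]; apply: AB. Qed.

Lemma mspan_min A B : is_submod B -> A `<=` B -> mspan A `<=` B.
Proof. by move=> sB AB v; apply. Qed.

Lemma mspan_id A : is_submod A -> mspan A = A.
Proof.
by move=> sA; apply/seteqP; split; [apply: mspan_min | apply: sub_mspan].
Qed.

End Submodules.
Arguments addS {R V}.

(** * Chains of submodules and additivity of length *)

Section Chains.
Variables (R : comPzRingType) (V : lmodType R).
Implicit Types (A B C N : set V).

(** Chains grow at the top and keep no indexing function, so that plain induction applies; [chainP]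
    links them to [submod_chain]. *)
Inductive chain : set V -> set V -> nat -> Prop :=
| chain_refl A : is_submod A -> chain A A 0
| chain_step A B C n : chain B C n -> is_submod A -> B `<` A -> chain A C n.+1.

Lemma chainP A B n : (exists M, submod_chain A B n M) <-> chain A B n.
Proof.
split=> [[M]|].
  elim: n A => [|n IHn] A [M0 Mn sM ltM].
    by rewrite -Mn M0; apply: chain_refl; rewrite -M0; apply: sM.
  apply: (@chain_step _ (M n)).
  - by apply: IHn; split=> // i le_in; [apply/sM/leqW | apply/ltM/leqW].
  - by rewrite -Mn; apply: sM.
  - by rewrite -Mn; apply: ltM.
elim=> {A B n} [A sA|A B C n _ [M [M0 Mn sM ltM]] sA ltBA].
  by exists (fun=> A); split.
exists (fun i => if (i <= n)%N then M i else A); split=> //.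
- by rewrite ltnn.
- by move=> i _; case: ifP => // /sM.
- move=> i; rewrite ltnS => le_in; rewrite le_in; case: ifP => [/ltM //|].
  by move=> /negbT; rewrite -ltnNge ltnS => le_ni; rewrite (_ : i = n) ?Mn //;
     apply/eqP; rewrite eqn_leq le_in.
Qed.

Lemma is_lengthP A B n :
  is_length A B n <-> chain A B n /\ (forall k, chain A B k -> (k <= n)%N).
Proof.
rewrite /is_length chainP; split=> -[cn max]; split=> // k.
  by case/chainP=> M; apply: max.
by move=> M cM; apply/max/chainP; exists M.
Qed.

Lemma is_length_uniq A B n p : is_length A B n -> is_length A B p -> n = p.
Proof.
move=> /is_lengthP[cn nP] /is_lengthP[cp pP].
by apply/eqP; rewrite eqn_leq nP ?pP.
Qed.

Lemma mlengthE A B n : is_length A B n -> mlength A B = n.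
Proof.
move=> lenn; have lenm : [set n | is_length A B n] (mlength A B) by apply: xgetPex;
  exists n.
exact: is_length_uniq lenm lenn.
Qed.

Lemma chain_submod A B n : chain A B n -> [/\ is_submod A, is_submod B & B `<=` A].
Proof.
elim=> [{}A sA|{A B n} A B C n _ [sB sC CB] sA ltBA]; split=> //.
by apply: subset_trans CB _; apply: properW.
Qed.

Lemma chain_cat A B C n k : chain A B n -> chain B C k -> chain A C (n + k).
Proof.
by move=> cAB cBC; elim: cAB cBC => // {A B n} A B D n _ IH sA ltBA /IH;
  rewrite addSn => h; apply: chain_step ltBA.
Qed.

Lemma chain_le A B C n : chain B C n -> is_submod A -> B `<=` A ->
  exists2 k, (n <= k)%N & chain A C k.
Proof.
move=> cBC sA BA; have [AB|nAB] := pselect (A `<=` B).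
  by exists n => //; rewrite (_ : A = B) //; apply/seteqP.
by exists n.+1 => //; apply: chain_step cBC sA _; split.
Qed.

(* Each strict step of the chain stays strict after intersecting with C or
   after adding C, by the modular law. *)
Lemma chain_split A B C n : is_submod C -> chain A B n ->
  exists p q, [/\ (n <= p + q)%N, chain (A `&` C) (B `&` C) p
                 & chain (addS A C) (addS B C) q].
Proof.
move=> sC; elim=> {A B n} [A sA|A B D n cB [p [q [le_n cp cq]]] sA ltBA].
  by exists 0%N, 0%N; split=> //; apply: chain_refl; [apply: submodI | apply: submod_addS].
have BA := properW ltBA.
have sAC := submodI sA sC; have sADC := submod_addS sA sC.
have BAC : B `&` C `<=` A `&` C by apply: setSI.
have BADC : addS B C `<=` addS A C.
  apply: addS_min => //; last exact: sub_addSr.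
  by apply: subset_trans BA _; apply: sub_addSl.
have [ACB|nACB] := pselect (A `&` C `<=` B `&` C); last first.
  have [q' le_q cq'] := chain_le cq sADC BADC.
  exists p.+1, q'; split=> //; first by rewrite addSn ltnS (leq_trans le_n) // leq_add2l.
  by apply: chain_step cp sAC _.
have [ADB|nADB] := pselect (addS A C `<=` addS B C); last first.
  have [p' le_p cp'] := chain_le cp sAC BAC.
  exists p', q.+1; split=> //; first by rewrite addnS ltnS (leq_trans le_n) // leq_add2r.
  by apply: chain_step cq sADC _.
have [sB _ _] := chain_submod cB; case: (ltBA) => _ []; move=> a aA.
have /addSP[b [c [bB cC e]]] : addS B C a by apply/ADB/sub_addSl.
rewrite e; apply: submodD => //; suff [] : (B `&` C) c by [].
have -> : c = a - b by rewrite e [b + c]addrC addrK.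
by apply: ACB; split; [apply: submodB => //; apply: BA | rewrite e [b + c]addrC addrK].
Qed.

(** Finiteness is carried separately because [mlength] is also 0 on infinite length. *)
Definition finlen A B : Prop := exists n, is_length A B n.

Lemma finlenP A B : finlen A B <-> is_length A B (mlength A B).
Proof. by split=> [[n lenn]|lenn]; [rewrite (mlengthE lenn) | exists (mlength A B)]. Qed.

Lemma finlen_bounded A B n : is_submod A -> is_submod B -> B `<=` A ->
  (forall k, chain A B k -> (k <= n)%N) -> finlen A B.
Proof.
move=> sA sB BA nP.
have [k0 _ c0] := chain_le (chain_refl sB) sA BA.
pose P k := `[< chain A B k >].
have exP : exists k, P k by exists k0; apply/asboolP.
have ubP k : P k -> (k <= n)%N by move/asboolP/nP.
case: (ex_maxnP exP ubP) => p /asboolP cp pP; exists p; apply/is_lengthP.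
by split=> // k ck; apply/pP/asboolP.
Qed.

(** Splitting an arbitrary chain of A / B along C gives chains of A / C and C / B, bounded by p and
    q. *)
Lemma is_length_cat A B C p q : is_length A C p -> is_length C B q ->
  is_length A B (p + q).
Proof.
move=> /is_lengthP[cp pP] /is_lengthP[cq qP]; apply/is_lengthP.
split=> [|k ck]; first exact: chain_cat cp cq.
have [sA sC CA] := chain_submod cp; have [_ sB BC] := chain_submod cq.
have [p' [q' [le_k cp' cq']]] := chain_split sC ck.
apply: leq_trans le_k _; rewrite addnC; apply: leq_add.
  apply: pP; have -> : A = addS A C by rewrite addS_absorb.
  suff {2}<- : addS B C = C by [].
  by apply/seteqP; split; [apply: addS_min | apply: sub_addSr].
by apply: qP; rewrite -[X in chain X _ _](setIidr CA) -[X in chain _ X _](setIidl BC).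
Qed.

Lemma finlen_cat A B C : finlen A C -> finlen C B -> finlen A B.
Proof. by move=> [p lp] [q lq]; exists (p + q)%N; apply: is_length_cat lp lq. Qed.

Lemma finlen_submod A B : finlen A B -> [/\ is_submod A, is_submod B & B `<=` A].
Proof. by case=> n /is_lengthP[/chain_submod]. Qed.

Lemma finlenl A B C : finlen A B -> is_submod C -> B `<=` C -> C `<=` A -> finlen A C.
Proof.
move=> fAB sC BC CA; have [sA sB BA] := finlen_submod fAB.
case: fAB => n /is_lengthP[_ nP].
apply: (finlen_bounded (n := n)) => // k ck.
have [j _ cj] := chain_le (chain_refl sB) sC BC.
by apply: leq_trans (nP _ (chain_cat ck cj)); rewrite leq_addr.
Qed.

Lemma finlenr A B C : finlen A B -> is_submod C -> B `<=` C -> C `<=` A -> finlen C B.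
Proof.
move=> fAB sC BC CA; have [sA sB BA] := finlen_submod fAB.
case: fAB => n /is_lengthP[_ nP].
apply: (finlen_bounded (n := n)) => // k ck.
have [j _ cj] := chain_le (chain_refl sC) sA CA.
by apply: leq_trans (nP _ (chain_cat cj ck)); rewrite leq_addl.
Qed.

Lemma mlengthD A B C : finlen A B -> is_submod C -> B `<=` C -> C `<=` A ->
  mlength A B = (mlength A C + mlength C B)%N.
Proof.
move=> fAB sC BC CA; apply: mlengthE.
by apply: is_length_cat; apply/finlenP; [apply: (finlenl fAB) | apply: (finlenr fAB)].
Qed.

Lemma is_length_refl A : is_submod A -> is_length A A 0.
Proof.
move=> sA; apply/is_lengthP; split=> [|k ck]; first exact: chain_refl.
case: k ck => // k ck; inversion ck as [|? D ? ? cD _ [_ nAD]]; subst.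
by have [_ _ /nAD] := chain_submod cD.
Qed.

End Chains.

(** * Transport of length along a linear map *)

Section Transfer.
Variables (R : comPzRingType) (V W : lmodType R) (f : {linear V -> W}).
Implicit Types (A : set V) (B : set W).

Lemma submod_image A : is_submod A -> is_submod (f @` A).
Proof.
move=> sA; apply/submodP; split; first by exists 0; [apply: submod0 | rewrite raddf0].
move=> a _ _ [u uA <-] [v vA <-]; exists (a *: u + v); first exact: submodZD.
by rewrite linearP.
Qed.

Lemma submod_preimage B : is_submod B -> is_submod (f @^-1` B).
Proof.
move=> sB; apply/submodP; split; first by rewrite /preimage /= raddf0; apply: submod0.
by move=> a u v uB vB; rewrite /preimage /= linearP; apply: submodZD.
Qed.

(** The last hypothesis makes the induced map A / A' -> W / (f A' + B) injective, so strict
    inclusions stay strict. *)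
Lemma chain_image A A' B n : is_submod B -> chain A A' n -> f @^-1` B `&` A `<=` A' ->
  chain (addS (f @` A) B) (addS (f @` A') B) n.
Proof.
move=> sB; elim=> {A A' n} [A sA|A A1 A2 n c1 IH sA ltA] kA.
  by apply: chain_refl; apply: submod_addS => //; apply: submod_image.
have A1A := properW ltA; have [sA1 sA2 A21] := chain_submod c1.
have sBA : is_submod (addS (f @` A) B) by apply: submod_addS => //; apply: submod_image.
have sBA1 : is_submod (f @` A1) by apply: submod_image.
apply: chain_step => //; first by apply: IH => v [vB /A1A vA]; apply: kA.
split.
  apply: addS_min => //.
    by move=> _ [u /A1A uA <-]; apply: sub_addSl => //; exists u.
  by apply: sub_addSr; apply: submod_image.
move=> e; case: ltA => _; apply=> a aA.
have : addS (f @` A1) B (f a) by apply: e; apply: sub_addSl => //; exists a.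
case/addSP=> _ [b [[u uA1 <-] bB e']]; rewrite -[a](subrK u); apply: submodD => //.
apply: A21; apply: kA; split; last by apply: submodB => //; apply: A1A.
by rewrite /preimage /= linearB e' addrC addKr.
Qed.

(** Every class of B modulo B' has a representative in f A, so strict inclusions survive in A. *)
Lemma chain_preimage A B B' n : is_submod A -> chain B B' n -> B `<=` addS (f @` A) B' ->
  chain (A `&` f @^-1` B) (A `&` f @^-1` B') n.
Proof.
move=> sA; elim=> {B B' n} [B sB|B B1 B2 n c1 IH sB ltB] kB.
  by apply: chain_refl; apply: submodI => //; apply: submod_preimage.
have B1B := properW ltB; have [sB1 sB2 B21] := chain_submod c1.
apply: chain_step (IH _) _ _; first exact: subset_trans kB.
  by apply: submodI => //; apply: submod_preimage.
split; first by apply: setIS => v /B1B.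
move=> e; case: ltB => _; apply=> b bB.
have /addSP[_ [b2 [[u uA <-] b2B e']]] := kB _ bB.
rewrite e'; apply: submodD; rewrite ?(B21 _ b2B) //; last exact: B21.
suff [] : (A `&` f @^-1` B1) u by [].
apply: e; split=> //; rewrite /preimage /= -[f u](addrK b2) -e'.
by apply: submodB => //; apply/B1B/B21.
Qed.

(** First isomorphism theorem: f induces an isomorphism from A / (A cap f^-1 B) to (f A + B) / B,
    and chains correspond under images and preimages. *)
Lemma is_length_transfer A B n : is_submod A -> is_submod B ->
  is_length A (A `&` f @^-1` B) n <-> is_length (addS (f @` A) B) B n.
Proof.
move=> sA sB.
suff E k : chain A (A `&` f @^-1` B) k <-> chain (addS (f @` A) B) B k.
  by rewrite !is_lengthP; split=> -[/E cn nP]; split=> // k /E; apply: nP.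
have sfA := submod_image sA.
split=> c.
  have -> : B = addS (f @` (A `&` f @^-1` B)) B.
    apply/seteqP; split; first by apply/sub_addSr/submod_image/submodI => //;
      apply: submod_preimage.
    by apply: addS_min => // _ [u [_ uB] <-].
  have -> : addS (f @` A) (addS (f @` (A `&` f @^-1` B)) B) = addS (f @` A) B.
    congr addS; apply/seteqP; split; first by apply: addS_min => // _ [u [_ uB] <-].
    by apply/sub_addSr/submod_image/submodI => //; apply: submod_preimage.
  by apply: chain_image => // u [].
have -> : A = A `&` f @^-1` (addS (f @` A) B).
  apply/seteqP; split=> [a aA|a []//]; split=> //.
  by apply: sub_addSl => //; exists a.
have -> : A `&` f @^-1` addS (f @` A) B `&` f @^-1` B = A `&` f @^-1` B.
  apply/seteqP; split=> [a [[]]//|a [aA aB]]; split=> //; split=> //.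
  exact: sub_addSr.
exact: chain_preimage.
Qed.

Lemma finlen_transfer A B : is_submod A -> is_submod B ->
  finlen A (A `&` f @^-1` B) <-> finlen (addS (f @` A) B) B.
Proof.
by move=> sA sB; split=> -[n nP]; exists n; apply/is_length_transfer.
Qed.

Lemma mlength_transfer A B : is_submod A -> is_submod B ->
  mlength A (A `&` f @^-1` B) = mlength (addS (f @` A) B) B.
Proof.
move=> sA sB; rewrite /mlength; congr (xget 0%N _); apply/seteqP.
by split=> n /=; rewrite is_length_transfer.
Qed.

End Transfer.

(** * Finite powers of a module *)

Section FiniteProduct.
Variables (R : comPzRingType) (U : lmodType R) (T : finType) (P : set U).

(** As s grows this interpolates between the whole power and the power of P. *)
Definition ffun_sub (s : seq T) : set {ffun T -> U} :=
  [set c | forall t, t \in s -> P (c t)].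

Lemma submod_ffun_sub s : is_submod P -> is_submod (ffun_sub s).
Proof.
move=> sP; apply/submodP; split=> [t _|a u v uP vP t ts]; rewrite !ffunE.
  exact: submod0.
by apply: submodZD => //; [apply: uP | apply: vP].
Qed.

Definition ffun_eval (t : T) (c : {ffun T -> U}) : U := c t.

Lemma ffun_eval_linear t : linear (ffun_eval t).
Proof. by move=> a u v; rewrite /ffun_eval !ffunE. Qed.

HB.instance Definition _ t :=
  GRing.isLinear.Build R {ffun T -> U} U _ (ffun_eval t) (ffun_eval_linear t).

(** Evaluation at a new coordinate t identifies the layer between s and t :: s with U / P. *)
Lemma is_length_ffun_sub s n : uniq s -> is_length [set: U] P n ->
  is_length [set: {ffun T -> U}] (ffun_sub s) (size s * n).
Proof.
move=> us lenn.
have sP : is_submod P by case/is_lengthP: lenn => /chain_submod[].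
elim: s us => [_|t s IHs /= /andP[ts us]].
  rewrite (_ : ffun_sub [::] = setT); first exact/is_length_refl/submodT.
  by apply/seteqP; split.
rewrite mulSn addnC; apply: is_length_cat (IHs us) _.
have -> : ffun_sub (t :: s) = ffun_sub s `&` ffun_eval t @^-1` P.
  apply/seteqP; split=> [c cP|c [cP ct] t']; rewrite ?inE.
    by split=> [t' ts'|]; apply: cP; rewrite inE ?eqxx // ts' orbT.
  by case/predU1P=> [->|/cP].
apply/is_length_transfer => //; first exact: submod_ffun_sub.
suff -> : addS (ffun_eval t @` ffun_sub s) P = setT by [].
apply/seteqP; split=> // u _; apply: sub_addSl => //.
exists [ffun t' => if t' == t then u else 0]; last by rewrite /= /ffun_eval ffunE eqxx.
move=> t' ts'; rewrite ffunE ifN; first exact: submod0.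
by apply: contraNneq ts => <-.
Qed.

Lemma is_length_ffun n : is_length [set: U] P n ->
  is_length [set: {ffun T -> U}] [set c | forall t, P (c t)] (#|T| * n).
Proof.
move=> lenn; rewrite cardE.
rewrite [X in is_length _ X](_ : _ = ffun_sub (enum T)).
  by apply: is_length_ffun_sub => //; apply: enum_uniq.
by apply/seteqP; split=> c cP t *; apply: cP; rewrite ?mem_enum.
Qed.

End FiniteProduct.

(** * Ideals of a noetherian local ring *)

Section IdealTheory.
Variable R : comPzRingType.
Implicit Types (I J K A B m : set R).

Lemma idealP I : is_ideal I <->
  I 0 /\ (forall a u v, I u -> I v -> I (a * u + v)).
Proof. exact: (@submodP R R^o I). Qed.

Lemma ideal0 I : is_ideal I -> I 0.
Proof. exact: (@submod0 R R^o I). Qed.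

Lemma idealD I u v : is_ideal I -> I u -> I v -> I (u + v).
Proof. exact: (@submodD R R^o I). Qed.

Lemma idealN I u : is_ideal I -> I u -> I (- u).
Proof. exact: (@submodN R R^o I). Qed.

Lemma ideal_mull I a u : is_ideal I -> I u -> I (a * u).
Proof. exact: (@submodZ R R^o I). Qed.

Lemma ideal_mulr I a u : is_ideal I -> I u -> I (u * a).
Proof. by rewrite mulrC; apply: ideal_mull. Qed.

Lemma ideal_sum I (T : Type) (r : seq T) (P : pred T) (F : T -> R) :
  is_ideal I -> (forall i, P i -> I (F i)) -> I (\sum_(i <- r | P i) F i).
Proof. exact: (@submod_sum R R^o I). Qed.

Lemma ideal1 I : is_ideal I -> I 1 -> I = setT.
Proof.
by move=> idI I1; apply/seteqP; split=> // a _; rewrite -[a]mulr1; apply: ideal_mull.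
Qed.

Lemma idealT : is_ideal [set: R].
Proof. exact: (@submodT R R^o). Qed.

Lemma ideal_gen_ideal A : is_ideal (ideal_gen A).
Proof. exact: (@mspan_is_submod R R^o A). Qed.

Lemma sub_ideal_gen A : A `<=` ideal_gen A.
Proof. exact: (@sub_mspan R R^o A). Qed.

Lemma ideal_gen_min A I : is_ideal I -> A `<=` I -> ideal_gen A `<=` I.
Proof. exact: (@mspan_min R R^o A I). Qed.

Lemma addI_ideal I J : is_ideal I -> is_ideal J -> is_ideal (addI I J).
Proof. exact: (@submod_addS R R^o I J). Qed.

Lemma addIP I J v : addI I J v <-> exists a b, [/\ I a, J b & v = a + b].
Proof. exact: (@addSP R R^o I J v). Qed.

Lemma sub_addIl I J : is_ideal J -> I `<=` addI I J.
Proof. exact: (@sub_addSl R R^o I J). Qed.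

Lemma sub_addIr I J : is_ideal I -> J `<=` addI I J.
Proof. exact: (@sub_addSr R R^o I J). Qed.

Lemma addI_min I J K : is_ideal K -> I `<=` K -> J `<=` K -> addI I J `<=` K.
Proof. exact: (@addS_min R R^o I J K). Qed.

Lemma setI_ideal I J : is_ideal I -> is_ideal J -> is_ideal (I `&` J).
Proof. exact: (@submodI R R^o I J). Qed.

Lemma mulI_ideal I J : is_ideal (mulI I J).
Proof. exact: ideal_gen_ideal. Qed.

Lemma mulI_in I J a b : I a -> J b -> mulI I J (a * b).
Proof. by move=> aI bJ; apply: sub_ideal_gen; exists a => //; exists b. Qed.

Lemma mulI_min I J K : is_ideal K -> (forall a b, I a -> J b -> K (a * b)) ->
  mulI I J `<=` K.
Proof. by move=> idK IJK; apply: ideal_gen_min => // _ [a aI [b bJ <-]]; apply: IJK. Qed.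

Lemma mulI_subl I J : is_ideal I -> mulI I J `<=` I.
Proof. by move=> idI; apply: mulI_min => // a b aI _; apply: ideal_mulr. Qed.

Lemma mulI_subr I J : is_ideal J -> mulI I J `<=` J.
Proof. by move=> idJ; apply: mulI_min => // a b _; apply: ideal_mull. Qed.

Lemma mulIT I : is_ideal I -> mulI I setT = I.
Proof.
move=> idI; apply/seteqP; split; first exact: mulI_subl.
by move=> a aI; rewrite -[a]mulr1; apply: mulI_in.
Qed.

Lemma expI_ideal I n : is_ideal (expI I n).
Proof. by case: n => [|n]; [apply: idealT | apply: mulI_ideal]. Qed.

Lemma expIS I n : expI I n.+1 = mulI I (expI I n).
Proof. by []. Qed.

Lemma expI_in I a n : I a -> expI I n (a ^+ n).
Proof.
move=> aI; elim: n => [|n IHn]; first by rewrite expr0.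
by rewrite exprS expIS; apply: mulI_in.
Qed.

Lemma expI_leS I n : expI I n.+1 `<=` expI I n.
Proof. by apply: mulI_subr; apply: expI_ideal. Qed.

Lemma expI_le I n k : (n <= k)%N -> expI I k `<=` expI I n.
Proof.
move=> /subnKC <-; elim: (k - n)%N => [|j IHj]; first by rewrite addn0.
by rewrite addnS; apply: subset_trans IHj; apply: expI_leS.
Qed.

Lemma ideal_genP (d : nat) (x : 'I_d -> R) (P : pred 'I_d) v :
  ideal_gen [set x j | j in [set j | P j]] v <->
  exists2 a : 'I_d -> R, (forall j, ~~ P j -> a j = 0) & v = \sum_j x j * a j.
Proof.
split=> [|[a aP ->]]; last first.
  apply: ideal_sum => [|j _]; first exact: ideal_gen_ideal.
  have [Pj|/aP->] := boolP (P j); last by rewrite mulr0; apply: ideal0;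
    apply: ideal_gen_ideal.
  by apply: (ideal_mulr _ (ideal_gen_ideal _)); apply: sub_ideal_gen; exists j.
move: v; apply: ideal_gen_min.
  apply/idealP; split; first by exists (fun=> 0); rewrite ?big1 // => j; rewrite mulr0.
  move=> c _ _ [a aP ->] [b bP ->]; exists (fun j => c * a j + b j) => [j nPj|].
    by rewrite aP // bP // mulr0 addr0.
  rewrite big_distrr -big_split; apply: eq_bigr => j _ /=.
  by rewrite mulrDr mulrCA.
move=> _ [i /= Pi <-]; exists (fun j => (j == i)%:R) => [j nPj|].
  by case: eqP nPj => // ->; rewrite Pi.
by rewrite (bigD1 i) //= eqxx mulr1 big1 ?addr0 // => j /negbTE->; rewrite mulr0.
Qed.

Lemma range_genP (d : nat) (x : 'I_d -> R) v :
  ideal_gen (range x) v <-> exists a : 'I_d -> R, v = \sum_j x j * a j.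
Proof.
have -> : range x = [set x j | j in [set j | predT j]].
  by apply/seteqP; split=> _ [j _ <-]; exists j.
by rewrite ideal_genP; split=> [[a _ ->]|[a ->]]; exists a.
Qed.

Lemma mulI_rangeP (d : nat) (x : 'I_d -> R) J v : is_ideal J ->
  mulI (ideal_gen (range x)) J v <->
  exists2 a : 'I_d -> R, (forall j, J (a j)) & v = \sum_j x j * a j.
Proof.
move=> idJ; split=> [|[a aJ ->]]; last first.
  apply: ideal_sum => [|j _]; first exact: mulI_ideal.
  by apply: mulI_in => //; apply: sub_ideal_gen; exists j.
move: v; apply: mulI_min => [|u b /range_genP[a ->] bJ].
  apply/idealP; split.
    by exists (fun=> 0); rewrite ?big1 // => j; rewrite ?mulr0 //; apply: ideal0.
  move=> c _ _ [a aP ->] [b bP ->]; exists (fun j => c * a j + b j) => [j|].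
    by apply: idealD => //; apply: ideal_mull.
  rewrite big_distrr -big_split; apply: eq_bigr => j _ /=.
  by rewrite mulrDr mulrCA.
exists (fun j => a j * b) => [j|]; first exact: ideal_mull.
by rewrite big_distrl; apply: eq_bigr => j _; rewrite mulrA.
Qed.

Lemma radicalS I J : I `<=` J -> radical I `<=` radical J.
Proof. by move=> IJ a [n aI]; exists n; apply: IJ. Qed.

End IdealTheory.

(** * Maximal elements, Nakayama's lemma and finite length *)

Section Noetherian.
Variable R : comPzRingType.
Hypothesis hN : noetherian R.
Implicit Types (I J K A B m : set R).

(** Otherwise choice builds a strictly increasing sequence in F; its union is finitely generated,
    hence equal to one of its terms. *)
Lemma noetherian_max (F : set (set R)) :
  (forall I, F I -> is_ideal I) -> F !=set0 ->
  exists2 M, F M & forall J, F J -> M `<=` J -> J `<=` M.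
Proof.
move=> idF [M0 FM0]; apply: contrapT => nmax.
have next (M : {M | F M}) : exists M' : {M | F M},
    sval M `<=` sval M' /\ ~ sval M' `<=` sval M.
  apply: contrapT => nM; apply: nmax; exists (sval M); first exact: svalP.
  move=> J FJ MJ; apply: contrapT => nJM; apply: nM.
  by exists (exist _ J FJ).
have [nxt nxtP] := choice next.
pose u n := sval (iter n nxt (exist _ M0 FM0)).
have idu n : is_ideal (u n) by apply/idF/svalP.
have uS n : u n `<=` u n.+1 by case: (nxtP (iter n nxt (exist _ M0 FM0))).
have ule n k : (n <= k)%N -> u n `<=` u k.
  move=> /subnKC <-; elim: (k - n)%N => [|j IHj]; first by rewrite addn0.
  by rewrite addnS; apply: subset_trans (uS _).
pose U := [set a | exists n, u n a].
have idU : is_ideal U.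
  apply/idealP; split; first by exists 0%N; apply: ideal0.
  move=> a v w [n vn] [k wk]; exists (maxn n k).
  apply: idealD => //; last by apply: ule wk; apply: leq_maxr.
  by apply: ideal_mull => //; apply: ule vn; apply: leq_maxl.
have [s Us] := hN idU.
have [n nP] : exists n, forall a, a \in s -> u n a.
  have : forall a, a \in s -> U a by move=> a as_; rewrite Us; apply: sub_ideal_gen.
  elim: s {Us} => [|a s IHs] sU; first by exists 0%N.
  have [n nP] : exists n, forall a, a \in s -> u n a.
    by apply: IHs => b bs; apply: sU; rewrite inE bs orbT.
  have [k ak] : U a by apply: sU; rewrite inE eqxx.
  exists (maxn n k) => b; rewrite inE => /predU1P[->|/nP bn].
    by apply: ule ak; apply: leq_maxr.
  by apply: ule bn; apply: leq_maxl.
have [_] := nxtP (iter n nxt (exist _ M0 FM0)); apply=> a ua.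
have : U a by exists n.+1.
by rewrite Us => /(ideal_gen_min (idu n)); apply.
Qed.

Variable m : set R.
Hypothesis hL : local_ring m.

Let idm : is_ideal m. Proof. by case: hL => [[]]. Qed.

Lemma local_proper : ~ m 1.
Proof. by move=> m1; case: hL => [[_ nmT _] _]; apply/nmT/ideal1. Qed.

(** If u were not a unit, an ideal maximal among those containing u but not 1 would be a maximal
    ideal, hence m. *)
Lemma local_unit u : ~ m u -> exists v, v * u = 1.
Proof.
move=> num; apply: contrapT => nu.
pose F := [set J : set R | [/\ is_ideal J, J u & ~ J 1]].
have [|M [idM Mu nM1] maxM] := @noetherian_max F (fun J => ltac:(by case)).
  exists [set v | exists r, v = r * u]; split; last by case=> r e; apply: nu; exists r.
    apply/idealP; split; first by exists 0; rewrite mul0r.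
    by move=> a _ _ [r ->] [s ->]; exists (a * r + s); rewrite mulrDl mulrA.
  by exists 1; rewrite mul1r.
have : is_maximal M.
  split=> // [MT|J idJ MJ]; first by apply: nM1; rewrite MT.
  have [J1|nJ1] := pselect (J 1); first by right; apply: ideal1.
  by left; apply/seteqP; split=> //; apply: maxM => //; split=> //; apply: MJ.
by case: hL => _ uniq_m /uniq_m eM; apply: num; rewrite -eM.
Qed.

(** Take a in A with B + Ra maximal and write a = b + x a'. Then B + Ra lies in B + Ra', so a' = b'
    + r a by maximality, whence (1 - r x) a' lies in B. *)
Lemma nakayama A B x : m x -> is_ideal A -> is_ideal B ->
  (forall a, A a -> exists b a', [/\ B b, A a' & a = b + x * a']) -> A `<=` B.
Proof.
move=> mx idA idB AB.
pose E a := [set v | exists b r, B b /\ v = b + r * a].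
have idE a : is_ideal (E a).
  apply/idealP; split.
    by exists 0, 0; rewrite mul0r addr0; split=> //; apply: ideal0.
  move=> c _ _ [b [r [bB ->]]] [b' [r' [bB' ->]]].
  exists (c * b + b'), (c * r + r'); split; first by apply: idealD => //; apply: ideal_mull.
  by rewrite mulrDr mulrDl mulrA addrACA.
have [||_ [a aA <-] maxa] := @noetherian_max [set E a | a in A].
- by move=> _ [a _ <-].
- by exists (E 0); exists 0 => //; apply: ideal0.
have [b [a' [bB aA' e]]] := AB _ aA.
have [b' [r [bB' e']]] : E a a'.
  apply: (maxa (E a')); [by exists a' | | by exists 0, 1; rewrite mul1r add0r;
    split=> //; apply: ideal0].
  move=> _ [b1 [r1 [bB1 ->]]]; exists (b1 + r1 * b), (r1 * x).
  split; first by apply: idealD => //; apply: ideal_mull.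
  by rewrite e mulrDr !mulrA addrA.
(* r x lies in m, so 1 - r x does not: otherwise 1 would be in m. *)
have [v vP] : exists v, v * (1 - r * x) = 1.
  apply: local_unit => mrx; apply: local_proper.
  by rewrite -[1](subrK (r * x)); apply: idealD => //; apply: ideal_mull.
have aB' : B a'.
  rewrite -[a']mul1r -vP -mulrA; apply: ideal_mull => //.
  have -> : (1 - r * x) * a' = b' + r * b.
    by rewrite mulrBl mul1r {1}e' e mulrDr !mulrA addrA addrK.
  by apply: idealD => //; apply: ideal_mull.
have aB : B a by rewrite e; apply: idealD => //; apply: ideal_mull.
(* Since a is in B, B + Ra is contained in B + Rc; by maximality the two agree, and both equal B. *)
move=> c cA; have [b1 [r1 [bB1 ->]]] : E a c.
  apply: (maxa (E c)); [by exists c | | by exists 0, 1; rewrite mul1r add0r; split=> //;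
    apply: ideal0].
  move=> _ [b1 [r1 [bB1 ->]]]; exists (b1 + r1 * a), 0.
  by rewrite mul0r addr0; split=> //; apply: idealD => //; apply: ideal_mull.
by apply: idealD => //; apply: ideal_mull.
Qed.

(* Vectors are cut down one coordinate at a time, so that only the ideals of
   last coordinates are needed. *)
Lemma nakayama_ffun (d : nat) (x : R) (Z B : set {ffun 'I_d -> R^o}) : m x ->
  is_submod Z -> is_submod B ->
  (forall z, Z z -> exists b z', [/\ B b, Z z' & z = b + x *: z']) -> Z `<=` B.
Proof.
move=> mx sZ sB ZB.
suff E l : forall Z B : set {ffun 'I_d -> R^o}, is_submod Z -> is_submod B ->
    (forall z, Z z -> exists b z', [/\ B b, Z z' & z = b + x *: z']) ->
    (forall z, Z z -> forall j : 'I_d, (l <= j)%N -> z j = 0) -> Z `<=` B.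
  by apply: (E d) => // z _ j; rewrite leqNgt ltn_ord.
elim: l {Z B sZ sB ZB} => [|l IHl] Z B sZ sB ZB Zl.
  by move=> z zZ; rewrite (_ : z = 0); [apply: submod0 | apply/ffunP => j;
    rewrite ffunE Zl].
have [dl|ld] := leqP d l.
  apply: IHl => // z zZ j lj; apply: Zl => //.
  by have := leq_ltn_trans (leq_trans dl lj) (ltn_ord j); rewrite ltnn.
pose l' := Ordinal ld; pose ev : {linear {ffun 'I_d -> R^o} -> R^o} :=
  @ffun_eval R R^o 'I_d l'.
have sBZ : is_submod (B `&` Z) by apply: submodI.
have sk : is_submod (ev @^-1` [set 0]).
  by apply: (@submod_preimage _ _ _ ev); apply/submodP; split=> // a u v -> ->;
    rewrite scaler0 addr0.
have evZ : ev @` Z `<=` ev @` (B `&` Z).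
  apply: (@nakayama _ _ x) => //; try exact: submod_image.
  move=> _ [z zZ <-]; have [b [z' [bB zZ' e]]] := ZB z zZ.
  exists (ev b), (ev z'); split; [|by exists z'|by rewrite e linearD linearZ].
  exists b => //; split=> //; have -> : b = z - x *: z' by rewrite e addrK.
  by apply: submodB => //; apply: submodZ.
have Zk : Z `&` ev @^-1` [set 0] `<=` B `&` ev @^-1` [set 0].
  apply: IHl; try exact: submodI; last first.
    move=> z [zZ z0] j; rewrite leq_eqVlt => /predU1P[lj|]; last exact: Zl.
    by rewrite (_ : j = l') //; apply: val_inj.
  move=> z [zZ z0]; have [b [z' [bB zZ' e]]] := ZB z zZ.
  have [b' [bB' bZ'] e'] : (ev @` (B `&` Z)) (ev z') by apply: evZ; exists z'.
  (* Correcting z' by b', which has the same coordinate l, makes the hypothesis descend to vectors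
     whose coordinate l vanishes. *)
  have k0 : ev (z' - b') = 0 by rewrite linearB /= e' subrr.
  have e2 : z = (b + x *: b') + x *: (z' - b').
    by rewrite -addrA -scalerDr addrCA subrr addr0.
  exists (b + x *: b'), (z' - b'); split=> //; last by split=> //; apply: submodB.
  split; first by apply: submodD => //; apply: submodZ.
  have := z0; rewrite /preimage /= {1}e2 linearD /= linearZ /= k0 scaler0 addr0.
  by [].
move=> z zZ; have [b [bB bZ] e] : (ev @` (B `&` Z)) (ev z) by apply: evZ; exists z.
rewrite -[z](subrK b); apply: submodD => //.
suff [] : (B `&` ev @^-1` [set 0]) (z - b) by [].
by apply: Zk; split; [apply: submodB | rewrite /preimage /= linearB /= e subrr].
Qed.

(** Multiplication as a linear endomorphism of [R^o], so that lengths can be transferred along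
    it. *)
Definition mulr_by (a : R) (r : R^o) : R^o := (r : R) * a : R.

Lemma mulr_by_linear a : linear (mulr_by a).
Proof. by move=> c u v; rewrite /mulr_by mulrDl /GRing.scale /= mulrA. Qed.

HB.instance Definition _ a :=
  GRing.isLinear.Build R R^o R^o _ (mulr_by a) (mulr_by_linear a).

Definition colonI J a := [set r | J (r * a)].

Lemma colonI_ideal J a : is_ideal J -> is_ideal (colonI J a).
Proof. by move=> idJ; apply: (@submod_preimage R R^o R^o (mulr_by a) J). Qed.

Lemma finlen_max : @finlen R R^o setT m.
Proof.
apply: (@finlen_bounded _ _ _ _ 1) => // [|k]; first exact: idealT.
case: k => [|[|k]] // ck; inversion ck as [|? D ? ? cD _ [_ nTD]]; subst.
inversion cD as [|? D' ? ? cD' sD [_ nDD']]; subst.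
have [_ _ mD'] := chain_submod cD'; have [_ _ mD] := chain_submod cD.
case: hL => [[_ _ maxm] _]; case: (maxm D) => // eD; last by rewrite eD in nTD; case: nTD.
by case: nDD'; rewrite eD.
Qed.

(** In a maximal counterexample J, some a outside J has (J : a) = m. Then (J + Ra) / J is isomorphic
    to R / m, and R / (J + Ra) has finite length by maximality of J. *)
Lemma finlen_primary J : is_ideal J -> m `<=` radical J -> @finlen R R^o setT J.
Proof.
move=> idJ radJ; apply: contrapT => nfin.
pose F := [set J | [/\ is_ideal J, m `<=` radical J & ~ @finlen R R^o setT J]].
have [|{idJ radJ nfin}{}J [idJ radJ nfin] maxJ] :=
  @noetherian_max F (fun J => ltac:(by case)).
  by exists J.
have nJ1 : ~ J 1.
  move=> J1; apply: nfin; rewrite (ideal1 idJ J1).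
  by exists 0%N; apply: is_length_refl; apply: idealT.
have [||_ [a nJa <-] maxa] := @noetherian_max [set colonI J a | a in [set a | ~ J a]].
- by move=> _ [a _ <-]; apply: colonI_ideal.
- by exists (colonI J 1); exists 1.
(* If y a were outside J, maximality of (J : a) would keep every y^k a outside J, although a power
   of y lies in J. *)
have mcol : m `<=` colonI J a.
  move=> y my; apply: contrapT => nya.
  have nyk k : ~ J (y ^+ k * a).
    elim: k => [|k IHk]; first by rewrite mul1r.
    move=> Jk; apply: nya; apply: (maxa (colonI J (y ^+ k * a))).
    - by exists (y ^+ k * a).
    - by move=> r; rewrite /colonI /= mulrCA => ?; apply: ideal_mull.
    - by rewrite /colonI /= mulrA -exprS.
  by have [N yN] := radJ _ my; apply: (nyk N); apply: ideal_mulr.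
have ecol : colonI J a = m.
  case: (hL) => [[_ _ maxm] _]; case: (maxm _ (colonI_ideal a idJ) mcol) => // eT.
  have : colonI J a 1 by rewrite eT.
  by rewrite /colonI /= mul1r.
pose J' := @addS R R^o (mulr_by a @` setT) J.
have idJ' : is_ideal J'.
  by apply: addI_ideal => //; apply: (@submod_image R R^o R^o); apply: idealT.
have J'a : J' a by apply: sub_addIl => //; exists 1 => //; rewrite /mulr_by mul1r.
have JJ' : J `<=` J' by apply: sub_addIr; apply: (@submod_image R R^o R^o); apply: idealT.
apply: nfin; apply: (@finlen_cat _ _ _ _ J').
  apply: contrapT => nfin'; apply: nJa; apply: (maxJ J') => //; split=> //.
  by move=> y /radJ; apply: radicalS.
apply/finlen_transfer => //; first exact: idealT.
rewrite setTI (_ : _ @^-1` _ = m); [exact: finlen_max|exact: ecol].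
Qed.

End Noetherian.

(** * Koszul homology and regularity *)

(** Pairs (j, l) and (l, j) are matched, so no division by 2 occurs. *)
Lemma sum_antisym (V : zmodType) (d : nat) (F : 'I_d -> 'I_d -> V) :
  (forall j, F j j = 0) -> (forall j l : 'I_d, (j < l)%N -> F l j = - F j l) ->
  \sum_j \sum_l F j l = 0.
Proof.
move=> F0 FN.
have E j : \sum_l F j l = \sum_(l : 'I_d | (j < l)%N) F j l + \sum_(l : 'I_d | (l <
  j)%N) F j l.
  rewrite (bigID (fun l : 'I_d => (j < l)%N)) /=; congr (_ + _).
  rewrite (bigD1 j) ?ltnn //= F0 add0r; apply: eq_bigl => l.
  by rewrite -leqNgt [RHS]ltn_neqAle andbC.
under eq_bigr do rewrite E.
rewrite big_split /= [X in _ + X](exchange_big_dep predT) //= -big_split big1 // => j _ /=.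
rewrite -big_split big1 // => l jl /=; by rewrite (FN j l jl) subrr.
Qed.

(** * The Koszul complex on the whole exterior algebra *)

Section FullKoszul.
Variables (R : comPzRingType) (d : nat) (x : 'I_d -> R).
Implicit Types (S T : {set 'I_d}) (c b : {set 'I_d} -> R) (J : set R).

(** For j outside T, this sign relates the exterior product of e_j and e_T to the basis element of T
    with j added. *)
Definition ksign T (j : 'I_d) : R := (-1) ^+ #|[set k in T | (k < j)%N]%SET|.

(* The Koszul differential on the whole exterior algebra, a cochain being a
   function of all subsets; this avoids the dependent types kbasis i. *)
Definition kdiff c T : R := \sum_(j | j \notin T) ksign T j * x j * c (j |: T)%SET.

(** Left multiplication by e_a in the exterior algebra, on coefficients. *)
Definition khomotopy (a : 'I_d) c S : R :=
  if a \in S then ksign S a * c (S :\ a)%SET else 0.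

Lemma ksignU T (j l : 'I_d) : j \notin T ->
  ksign (j |: T)%SET l = (-1) ^+ (j < l)%N * ksign T l.
Proof.
move=> jT; rewrite /ksign -exprD; congr (_ ^+ _).
have [jl|lj] := boolP (j < l)%N.
  have -> : [set k in j |: T | (k < l)%N]%SET = (j |: [set k in T | (k < l)%N])%SET.
    by apply/setP => k; rewrite !inE andb_orl; case: eqP => // ->; rewrite jl.
  by rewrite cardsU1 inE (negbTE jT).
rewrite add0n; apply: eq_card => k; rewrite !inE andb_orl.
by case: eqP => // ->; rewrite (negbTE lj) andbF.
Qed.

Lemma ksignUx T (j : 'I_d) : j \notin T -> ksign (j |: T)%SET j = ksign T j.
Proof. by move=> jT; rewrite ksignU // ltnn mul1r. Qed.

Lemma ksignK T j : ksign T j * ksign T j = 1.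
Proof. by rewrite /ksign -exprMn mulrNN mulr1 expr1n. Qed.

(** The terms for (j, l) and (l, j) involve the same subset; adding the smaller index flips the sign
    attached to the larger one, so they cancel. *)
Lemma kdiff_kdiff c T : kdiff (kdiff c) T = 0.
Proof.
pose F j l := if [&& j \notin T, l \notin T & l != j] then
  (-1) ^+ (j < l)%N * (ksign T j * ksign T l * (x j * x l) * c (l |: (j |: T))%SET) else 0.
rewrite -[RHS](@sum_antisym _ _ F); last 2 first.
- by move=> j; rewrite /F eqxx !andbF.
- move=> j l jl; rewrite /F [l == j]eq_sym; case: ifP; last first.
    by rewrite andbCA => ->; rewrite oppr0.
  rewrite andbCA => ->; rewrite jl ltnNge ltnW //= mul1r expr1 mulN1r opprK.
  by rewrite [ksign T l * _]mulrC [x l * _]mulrC finset.setUCA.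
rewrite /kdiff big_mkcond; apply: eq_bigr => j _; case: ifP => jT; last first.
  by rewrite /F jT big1.
rewrite big_distrr big_mkcond; apply: eq_bigr => l _ /=.
rewrite /F jT !inE negb_or andbC /=; case: ifP => // /andP[lT lj].
rewrite ksignU // -!mulrA [RHS]mulrCA; congr (_ * _).
rewrite mulrCA; congr (_ * _); rewrite mulrCA; congr (_ * _).
Qed.

(** Cartan's formula: multiplication by x_a is null-homotopic. *)
Lemma khomotopyP a c T : kdiff (khomotopy a c) T + khomotopy a (kdiff c) T = x a * c T.
Proof.
have [aT|aT] := boolP (a \in T); last first.
  rewrite {2}/khomotopy (negbTE aT) addr0 /kdiff (bigD1 a) //= big1 ?addr0.
    rewrite /khomotopy finset.setU11 ksignUx // finset.setU1K //.
    by rewrite mulrCA !mulrA ksignK mul1r.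
  by move=> j /andP[jT ja]; rewrite /khomotopy !inE eq_sym (negbTE ja) (negbTE aT) mulr0.
have aTa : a \notin (T :\ a)%SET by rewrite !inE eqxx.
have sT j : ksign T j = (-1) ^+ (a < j)%N * ksign (T :\ a) j by rewrite -ksignU //
  finset.setD1K.
rewrite {2}/khomotopy aT {2}/kdiff (bigD1 a) //= finset.setD1K // sT ltnn mul1r.
rewrite mulrDr addrCA -[RHS]addr0; congr (_ + _).
  by rewrite !mulrA ksignK mul1r.
rewrite /kdiff [X in _ + _ * X](eq_bigl (fun j => j \notin T)) /=; last first.
  move=> j; rewrite !inE negb_and negbK; case: eqP => [->|] /=; rewrite ?andbF ?andbT //.
  by rewrite aT.
rewrite big_distrr -big_split big1 //= => j jT.
have ja : j != a by apply: contraNneq jT => ->.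
rewrite /khomotopy !inE aT orbT ksignU // [ksign T a]sT ltnn mul1r sT.
have -> : ((j |: T) :\ a = j |: (T :\ a))%SET.
  by apply/setP => k; rewrite !inE; case: eqP => // ->; rewrite (eq_sym a j) (negbTE ja).
set u := ksign _ a; set v := ksign _ j.
(* Exactly one of the two inequalities holds, so the two terms for j carry opposite signs. *)
have [ltaj|ltja] : (a < j)%N \/ (j < a)%N by apply/orP; rewrite -neq_ltn eq_sym.
  by rewrite ltaj ltnNge ltnW //= expr1 expr0; ring.
by rewrite ltja ltnNge ltnW //= expr1 expr0; ring.
Qed.

Lemma kdiff_lin (a : R) c b T :
  kdiff (fun S => a * c S + b S) T = a * kdiff c T + kdiff b T.
Proof.
by rewrite /kdiff big_distrr -big_split; apply: eq_bigr => j _ /=; ring.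
Qed.

Lemma kdiffZ (a : R) c T : kdiff (fun S => a * c S) T = a * kdiff c T.
Proof. by rewrite /kdiff big_distrr; apply: eq_bigr => j _ /=; ring. Qed.

Lemma kdiffB c b T : kdiff (fun S => c S - b S) T = kdiff c T - kdiff b T.
Proof. by rewrite /kdiff -sumrB; apply: eq_bigr => j _ /=; ring. Qed.

Lemma kdiff_sum (I : finType) (a : I -> R) (c : I -> {set 'I_d} -> R) T :
  kdiff (fun S => \sum_i a i * c i S) T = \sum_i a i * kdiff (c i) T.
Proof.
rewrite /kdiff; under eq_bigr do rewrite big_distrr.
rewrite exchange_big; apply: eq_bigr => i _; rewrite big_distrr.
by apply: eq_bigr => j _ /=; ring.
Qed.

Lemma kdiff_ideal J c i T : is_ideal J -> (forall S, #|S| = i.+1 -> J (c S)) ->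
  #|T| = i -> J (kdiff c T).
Proof.
move=> idJ cJ cT; apply: ideal_sum => // j jT; apply: ideal_mull => //; apply: cJ.
by rewrite cardsU1 jT cT.
Qed.

(* Vanishing of the Koszul homology of R / J in degree i + 1, stated in terms
   of lifts to R. *)
Definition kexact J i : Prop := forall c,
  (forall T, #|T| = i -> J (kdiff c T)) ->
  exists b, forall S, #|S| = i.+1 -> J (c S - kdiff b S).

Lemma kexact_large J i : (d <= i)%N -> kexact J i.
Proof.
move=> di c _; exists c => S cS; have := max_card (mem S).
by rewrite cS card_ord ltnNge di.
Qed.

(** The ideal generated by x kills the homology: for z = sum_j x_j a_j, the combination of the
    homotopies with coefficients a_j works. *)
Lemma kdiff_null J c i z : is_ideal J -> (forall T, #|T| = i -> J (kdiff c T)) ->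
  ideal_gen (range x) z ->
  exists b, forall S, #|S| = i.+1 -> J (z * c S - kdiff b S).
Proof.
move=> idJ cJ /range_genP[a ->].
exists (fun S => \sum_j a j * khomotopy j c S) => S cS.
rewrite kdiff_sum big_distrl -sumrB; apply: ideal_sum => // j _ /=.
rewrite -mulrA mulrCA -khomotopyP -mulrBr [_ + khomotopy _ _ _]addrC addrK.
apply: ideal_mull => //; rewrite /khomotopy; case: ifP => [jS|_]; last exact: ideal0.
apply: ideal_mull => //; apply: cJ; apply/eqP; rewrite -eqSS -cS.
by rewrite (cardsD1 j S) jS.
Qed.

(* Multiplication by y is injective on the homology of R / J, by the long exact
   sequence, and nilpotent. *)
Lemma kexact_regular J y i N : is_ideal J -> (forall a, J (y * a) -> J a) ->
  ideal_gen (range x) (y ^+ N) ->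
  kexact [set v | exists u r, J u /\ v = u + y * r] i.+1 -> kexact J i.
Proof.
move=> idJ regy Xy exJ c cJ.
have [b0 b0P] := kdiff_null idJ cJ Xy.
elim: N c cJ b0 b0P {Xy} => [|N IHN] c cJ b0 b0P.
  by exists b0 => S /b0P; rewrite mul1r.
(* The exponent is lowered one step at a time. *)
suff [b bP] : exists b, forall S, #|S| = i.+1 -> J (y ^+ N * c S - kdiff b S).
  exact: IHN b bP.
(* Modulo J the differential of b0 is y^(N+1) c, so b0 is a cycle modulo J + yR. *)
have [T|b' b'P] := exJ b0.
  move=> cT; exists (kdiff b0 T - y ^+ N.+1 * c T), (y ^+ N * c T).
  by split; [rewrite -opprB; apply: idealN => //; apply: b0P | rewrite exprS; ring].
have /choice[r rP] S : exists r, #|S| = i.+2 -> J (b0 S - kdiff b' S - y * r).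
  have [cS|ncS] := eqVneq #|S| i.+2; last by exists 0 => cS; rewrite cS eqxx in ncS.
  by have [u [r [uJ ->]]] := b'P S cS; exists r; rewrite addrK.
(* Applying the differential d to b0 = d b' + y r gives y^(N+1) c = y (d r) modulo J, and y
   cancels. *)
exists r => S cS; apply: regy.
have -> : y * (y ^+ N * c S - kdiff r S) = (y ^+ N.+1 * c S - kdiff b0 S)
    + kdiff (fun S => b0 S - kdiff b' S - y * r S) S.
  by rewrite !kdiffB kdiff_kdiff kdiffZ exprS; ring.
by apply: idealD => //; [apply: b0P | apply: kdiff_ideal rP cS].
Qed.

End FullKoszul.

Lemma qpi_eqP (R : comPzRingType) (J : set R) u v : is_ideal J ->
  qpi J u = qpi J v <-> J (u - v).
Proof.
move=> idJ; have eJ : @mspan R R^o J = J by apply: mspan_id.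
by split=> [/qmod_eqP|uv]; [move=> /set_mem; rewrite eJ | apply/qmod_eqP/mem_set;
  rewrite eJ].
Qed.

Lemma prefix_ideal_ideal (R : comPzRingType) d (x : 'I_d -> R) k :
  is_ideal (prefix_ideal x k).
Proof. exact: ideal_gen_ideal. Qed.

Lemma prefix_idealP (R : comPzRingType) d (x : 'I_d -> R) k v : prefix_ideal x k v <->
  exists2 a : 'I_d -> R, (forall j : 'I_d, (k <= j)%N -> a j = 0) & v = \sum_j x j * a j.
Proof.
apply: (iff_trans (ideal_genP x (fun j => (j < k)%N) v)).
by split=> -[a aP ->]; exists a => // j; have := aP j; rewrite -leqNgt.
Qed.

Lemma prefix_idealS (R : comPzRingType) d (x : 'I_d -> R) (k : 'I_d) v :
  prefix_ideal x k.+1 v <-> exists u r, prefix_ideal x k u /\ v = u + x k * r.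
Proof.
rewrite prefix_idealP; split=> [[a aP ->]|[u [r [/prefix_idealP[a aP ->] ->]]]].
  exists (\sum_j x j * (if (j < k)%N then a j else 0)), (a k); split.
    apply/prefix_idealP; exists (fun j : 'I_d => if (j < k)%N then a j else 0) => // j.
    by rewrite leqNgt => /negbTE->.
  rewrite (bigD1 k) //= addrC; congr (_ + _).
  rewrite [RHS](bigD1 k) //= ltnn mulr0 add0r; apply: eq_bigr => j jk.
  have [//|kj] := ltnP; rewrite aP // ltn_neqAle kj andbT.
  by apply: contraNneq jk => /val_inj->.
exists (fun j => if j == k then r else a j) => [j kj|].
  by rewrite ifN ?(aP _ (ltnW kj)) // -(inj_eq val_inj) gtn_eqF.
rewrite (bigD1 k) //= [RHS](bigD1 k) //= eqxx (aP k) // mulr0 add0r addrC; congr (_ + _).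
by apply: eq_bigr => j /negbTE->.
Qed.

Lemma prefix_ideal0 (R : comPzRingType) d (x : 'I_d -> R) v :
  prefix_ideal x 0 v <-> v = 0.
Proof.
rewrite prefix_idealP; split=> [[a a0 ->]|->].
  by rewrite big1 // => j _; rewrite a0 // mulr0.
by exists (fun=> 0) => //; rewrite big1 // => j _; rewrite mulr0.
Qed.

Lemma prefix_idealE (R : comPzRingType) d (x : 'I_d -> R) :
  prefix_ideal x d = ideal_gen (range x).
Proof.
apply/seteqP; split; apply: ideal_gen_min; try exact: ideal_gen_ideal.
  by move=> _ [j _ <-]; apply: sub_ideal_gen; exists j.
by move=> _ [j _ <-]; apply: sub_ideal_gen; exists j => //=.
Qed.

(** * From vanishing Koszul homology to regularity *)

Section ParameterSequence.
Variables (R : comPzRingType) (d : nat) (x : 'I_d -> R).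

Lemma regular_seqP (y : 'I_d -> R) (i : 'I_d) a : regular_seq y ->
  prefix_ideal y i (y i * a) -> prefix_ideal y i a.
Proof.
case=> reg _ yaJ; have idJ := prefix_ideal_ideal y i.
rewrite -[a]subr0; apply/(qpi_eqP _ _ idJ); apply: (reg i) => /=.
apply: etrans (qpiM _ _ _) (etrans _ (esym (qpiM _ _ _))).
by apply/(qpi_eqP _ _ idJ); rewrite mulr0 subr0.
Qed.

(** The elements of y are removed one by one. Modulo all of them only degrees above d are claimed,
    where there is nothing to prove; each removal gains one degree. *)
Lemma kexact_of_regular_seq (y : 'I_d -> R) i : regular_seq y ->
  (forall j, exists N, ideal_gen (range x) (y j ^+ N)) -> kexact x [set 0] i.
Proof.
move=> regy powy.
suff E k : (k <= d)%N -> forall i, (d - k <= i)%N -> kexact x (prefix_ideal y (d - k)) i.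
  have := E d (leqnn d) i; rewrite subnn => /(_ isT).
  rewrite (_ : prefix_ideal y 0 = [set 0]) //.
  by apply/seteqP; split=> v /prefix_ideal0.
elim: k => [_ j|k IHk kd j]; first by rewrite subn0; apply: kexact_large.
have ltd : (d - k.+1 < d)%N by rewrite subnS prednK ?leq_subr ?subn_gt0.
have eS : (d - k = (d - k.+1).+1)%N by rewrite subnS prednK // subn_gt0.
pose l := Ordinal ltd => le_j; have [N yN] := powy l.
apply: (@kexact_regular _ _ _ _ (y l) _ N) => //.
- exact: prefix_ideal_ideal.
- by move=> a; apply: (@regular_seqP y l).
have := IHk (ltnW kd) j.+1; rewrite eS => /(_ le_j).
congr kexact; apply/seteqP.
by split=> v; rewrite (prefix_idealS y l).
Qed.

(* c is an alternating matrix: its entries are the coefficients of r on the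
   trivial relations x_i e_j - x_j e_i with i, j <= k. *)
Definition koszul_relation (k : nat) (r : 'I_d -> R) : Prop :=
  exists c : 'I_d -> 'I_d -> R,
  [/\ forall j, c j j = 0, forall i j, c j i = - c i j,
      forall i j : 'I_d, (k <= i)%N -> c i j = 0 &
      forall j, r j = \sum_i x i * c i j].

(** This says H_1(x_1, ..., x_k; R) = 0. *)
Definition trivial_relations (k : nat) : Prop := forall r : 'I_d -> R,
  (forall j : 'I_d, (k <= j)%N -> r j = 0) -> \sum_j x j * r j = 0 -> koszul_relation k r.

(** A degree 2 chain b bounding r supplies the matrix: its entry at (i, j) is b at {i, j}, with the
    sign that makes it alternating. *)
Lemma kexact_trivial_relations : kexact x [set 0] 0 -> trivial_relations d.
Proof.
move=> ex r _ r0; pose c (S : {set 'I_d}) := \sum_(j in S) r j.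
have [T /eqP|b bP] := ex c.
  rewrite cards_eq0 => /eqP->; rewrite /= -r0 /kdiff.
  apply: eq_big => j; rewrite ?inE // => _.
  rewrite /ksign (_ : [set k in _ | _]%SET = finset.set0) ?cards0 ?mul1r.
    by rewrite /c finset.setU0 big_set1.
  by apply/setP => k; rewrite !inE.
exists (fun i j : 'I_d => if i == j then 0 else (-1) ^+ (j < i)%N * b (i |: [set j])%SET).
split=> [j|i j|i j di|j]; first by rewrite eqxx.
- rewrite eq_sym; case: eqP => [|/eqP]; first by rewrite oppr0.
  rewrite finset.setUC neq_ltn => /orP[ij|ji].
    by rewrite ij ltnNge ltnW //= expr1 expr0 mulN1r mul1r.
  by rewrite ji ltnNge ltnW //= expr1 expr0 mulN1r mul1r opprK.
- by have := leq_trans (ltn_ord i) di; rewrite ltnn.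
have := bP [set j]%SET; rewrite cards1 => /(_ erefl) /= /subr0_eq.
rewrite /c big_set1 => ->; rewrite /kdiff [RHS](bigD1 j) //= eqxx mulr0 add0r.
apply: eq_big => i; rewrite inE // => /negbTE ij; rewrite ij.
rewrite mulrA [x i * _]mulrC /ksign; congr (_ ^+ _ * _ * _).
have [ji|nji] := boolP (j < i)%N.
  rewrite (_ : [set k in _ | _]%SET = [set j]%SET) ?cards1 //.
  by apply/setP => k; rewrite !inE; case: eqP => // ->.
apply/eqP; rewrite cards_eq0; apply/eqP/setP => k; rewrite !inE.
by case: eqP => // ->; rewrite (negbTE nji).
Qed.

Variable m : set R.
Hypotheses (hN : noetherian R) (hL : local_ring m) (mx : forall j, m (x j)).

(** If H_1(x_1, ..., x_(k+1); R) vanishes, then x_(k+1) acts surjectively on H_1(x_1, ..., x_k; R),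
    and Nakayama's lemma applies. *)
Lemma trivial_relations_pred k : (k < d)%N -> trivial_relations k.+1 -> trivial_relations k.
Proof.
move=> kd IH r rk r0; pose l := Ordinal kd.
pose Z := [set r : {ffun 'I_d -> R^o} |
  (forall j : 'I_d, (k <= j)%N -> r j = 0) /\ \sum_j x j * r j = 0].
pose B := [set r : {ffun 'I_d -> R^o} | koszul_relation k r].
suff : Z `<=` B.
  have eZ : forall j, (finfun r : {ffun 'I_d -> R^o}) j = r j by move=> j; rewrite ffunE.
  move=> /(_ (finfun r)) [|c [c0 cN ck e]].
    by split=> [j kj|]; [rewrite eZ rk | under eq_bigr do rewrite eZ].
  by exists c; split=> // j; rewrite -e eZ.
apply: (nakayama_ffun hN hL (mx l)).
- apply/submodP; split; first by split=> [j _|]; rewrite ?ffunE // big1 // => j _;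
  rewrite ffunE mulr0.
  move=> a u v [uk u0] [vk v0]; split=> [j kj|];
    first by rewrite !ffunE uk // vk // scaler0 addr0.
  rewrite (eq_bigr (fun j => a * (x j * u j) + x j * v j)); last first.
    by move=> j _; rewrite !ffunE mulrDr; congr (_ + _); rewrite mulrCA.
  by rewrite big_split -big_distrr /= u0 v0 mulr0 addr0.
- apply/submodP; split.
    by exists (fun _ _ => 0); split=> // [i j|j]; rewrite ?oppr0 // ffunE big1 // => i _;
      rewrite mulr0.
  move=> a u v [c [c0 cN ck e]] [c' [c0' cN' ck' e']].
  exists (fun i j => a * c i j + c' i j); split=> [j|i j|i j ki|j].
  + by rewrite c0 c0' mulr0 addr0.
  + by rewrite cN cN'; ring.
  + by rewrite ck // ck' // mulr0 addr0.
  rewrite !ffunE e e' /GRing.scale /= big_distrr -big_split /=.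
  by apply: eq_bigr => i _; ring.
move=> {r rk r0} r [rk r0].
have [j /ltnW/rk//|//|c [c0 cN ck e]] := IH r.
have ck' (i j : 'I_d) : (k < j)%N -> c i j = 0 by move=> kj; rewrite cN ck ?oppr0.
pose c' (i j : 'I_d) : R := if (i < k)%N && (j < k)%N then c i j else 0.
(* The matrix is split into its leading k by k block and its row l. That row is itself a relation,
   because c is alternating and r vanishes at l. *)
exists [ffun j => \sum_i x i * c' i j : R^o], [ffun j => c l j : R^o]; split.
- exists c'; split=> [j|i j|i j ki|j]; rewrite /c' ?c0 ?if_same ?ffunE //.
    by rewrite andbC; case: ifP; rewrite ?oppr0 // cN.
  by rewrite ltnNge ki.
- split=> [j|].
    rewrite ffunE leq_eqVlt => /predU1P[kj|/ck'//].
    by rewrite (_ : j = l) ?c0 //; apply: val_inj.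
  have := e l; rewrite rk //= => /esym e0;
    apply: etrans (_ : - (\sum_i x i * c i l) = 0); last by rewrite e0 oppr0.
  by rewrite -sumrN; apply: eq_bigr => j _; rewrite ffunE cN mulrN.
apply/ffunP => j; rewrite !ffunE e (bigD1 l) //= addrC; congr (_ + _).
have [jk|kj] := ltnP j k; last first.
  rewrite [RHS]big1 => [|i _]; last by rewrite /c' (ltnNge j) kj andbF mulr0.
  have := e j; rewrite rk // (bigD1 l) //=; have [->|jl] := eqVneq j l.
    by rewrite c0 mulr0 add0r.
  rewrite ck' ?mulr0 ?add0r // ltn_neqAle kj andbT.
  by apply: contraNneq jl => kj'; apply/eqP/val_inj.
rewrite [RHS](bigD1 l) //= {1}/c' ltnn mulr0 add0r; apply: eq_bigr => i il.
rewrite /c' jk andbT; have [//|ki] := ltnP; rewrite ck //.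
by rewrite ltn_neqAle ki andbT; apply: contraNneq il => ki'; apply/eqP/val_inj.
Qed.

(** If x_k a = sum_(j < k) x_j b_j, then b completed by -a is a relation; an alternating matrix with
    zero diagonal expresses -a through the x_j with j < k. *)
Lemma trivial_relations_regular (k : 'I_d) a : trivial_relations d ->
  prefix_ideal x k (x k * a) -> prefix_ideal x k a.
Proof.
move=> trd /prefix_idealP[b bk e].
have trk : trivial_relations k.+1.
  rewrite -(subKn (ltn_ord k)); move: (leq_subr k.+1 d).
  elim: (d - k.+1)%N => [|j IHj] jd; first by rewrite subn0.
  have jd' : (d - j.+1 < d)%N by rewrite subnS prednK ?leq_subr ?subn_gt0.
  apply: trivial_relations_pred => //; rewrite subnS prednK ?subn_gt0 //.
  by apply: IHj; apply: ltnW.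
have [j kj||c [c0 cN ck e']] := trk (fun j => if j == k then - a else b j).
- by rewrite ifN ?(bk _ (ltnW kj)) // -(inj_eq val_inj) gtn_eqF.
- rewrite (bigD1 k) //= eqxx mulrN e (bigD1 k) //= bk // mulr0 add0r addrC.
  by rewrite -sumrB big1 // => j /negbTE->; rewrite subrr.
have := e' k; rewrite eqxx => ea; rewrite -[a]opprK ea -sumrN.
apply/prefix_idealP; exists (fun i : 'I_d => if (i < k)%N then - c i k else 0).
  by move=> j; rewrite leqNgt => /negbTE->.
apply: eq_bigr => i _; have [ik|] := ltnP; first by rewrite mulrN.
rewrite leq_eqVlt => /predU1P[ki|ki]; last by rewrite ck // mulr0 oppr0.
by rewrite (_ : i = k) ?c0 ?mulr0 ?oppr0 //; apply: val_inj.
Qed.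

End ParameterSequence.

(** * Superficial sequences and Hilbert functions *)

Section QuotientIdeals.
Local Open Scope quotient_scope.
Variables (R : comPzRingType) (Q : set R).
Implicit Types (A B I J : set R).

Lemma qpi0 : qpi Q 0 = 0.
Proof. exact: (raddf0 \pi_(@qmod R R^o Q)). Qed.

Lemma qpi_mul a b : qpi Q (a * b) = qpi Q a * qpi Q b.
Proof. exact/esym/qpiM. Qed.

Lemma qpi_image_ideal I : is_ideal I -> is_ideal (qpi Q @` I).
Proof.
move=> idI; apply/idealP; split; first by exists 0; [apply: ideal0 | apply: qpi0].
move=> a _ _ [u uI <-] [v vI <-]; rewrite -(qpiK a) -qpi_mul -qpiD.
by exists (repr a * u + v) => //; apply: idealD => //; apply: ideal_mull.
Qed.

Lemma qpi_preimage_ideal (J : set (qring Q)) : is_ideal J -> is_ideal (qpi Q @^-1` J).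
Proof.
move=> idJ; apply/idealP; split.
  by rewrite /preimage /= qpi0; apply: ideal0 idJ.
move=> a u v uJ vJ; rewrite /preimage /= qpiD qpi_mul.
by apply: idealD => //; apply: ideal_mull.
Qed.

Lemma qpi_mulI A B : mulI (qpi Q @` A) (qpi Q @` B) = qpi Q @` mulI A B.
Proof.
apply/seteqP; split.
  apply: mulI_min; first exact/qpi_image_ideal/mulI_ideal.
  move=> _ _ [a aA <-] [b bB <-]; rewrite -qpi_mul.
  by exists (a * b) => //; apply: mulI_in.
move=> _ [u uAB <-]; move: u uAB.
apply: mulI_min; first exact/qpi_preimage_ideal/mulI_ideal.
by move=> a b aA bB; rewrite /preimage /= qpi_mul; apply: mulI_in; [exists a|exists b].
Qed.

Lemma qpi_expI A n : expI (qpi Q @` A) n = qpi Q @` expI A n.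
Proof.
elim: n => [|n IHn]; last by rewrite !expIS IHn qpi_mulI.
by apply/seteqP; split=> // u _; exists (repr u) => //; rewrite qpiK.
Qed.

(** Superficiality at s = 1 gives x a = x b modulo Q with b in I1 I2^r; regularity of x modulo Q
    cancels x. *)
Lemma superficial_colon I1 I2 x : is_ideal Q -> is_ideal I1 ->
  (forall a, Q (x * a) -> Q a) ->
  superficial (qpi Q @` I2) (qpi Q @` I1) (qpi Q x) ->
  exists r0 : nat, forall r, (r0 <= r)%N -> forall a,
    addI Q (mulI I1 (expI I2 r.+1)) (x * a) -> addI Q (mulI I1 (expI I2 r)) a.
Proof.
move=> idQ idI1 regx [_ [r0 _ supx]]; exists r0 => r le_r a.
have e1 : expI (qpi Q @` I1) 1 = qpi Q @` I1 by apply: mulIT; apply: qpi_image_ideal.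
have := supx r.+1 1%N (leqW le_r); rewrite e1 !qpi_expI !qpi_mulI /= => /seteqP[sub _].
move=> /addIP[q [j [qQ jJ e]]].
have [|_ [b bJ <-]] := sub (qpi Q (x * a)).
  split.
    rewrite qpi_mul mulrC; apply: (ideal_mull _ (ideal_gen_ideal _)); exact: sub_ideal_gen.
  by exists j => //; apply/qpi_eqP => //; rewrite e opprD addrCA subrr addr0; apply: idealN.
rewrite -qpi_mul => /(qpi_eqP _ _ idQ); rewrite -mulrBr -opprB mulrN => xQ.
apply/addIP; exists (a - b), b; split=> //; last by rewrite subrK.
by apply: regx; rewrite -[x * _]opprK; apply: idealN.
Qed.

End QuotientIdeals.

Definition diffz (f : int -> int) (n : int) : int := f n - f (n - 1).

(** * Hilbert functions modulo initial segments of x *)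

Section HilbertFunction.
Variables (R : comPzRingType) (m I1 I2 : set R).
Hypotheses (hN : noetherian R) (hL : local_ring m).
Hypothesis idI1 : is_ideal I1.
Hypotheses (rI1 : m `<=` radical I1) (rI2 : m `<=` radical I2).

Lemma radical_mulI_expI n : m `<=` radical (mulI I1 (expI I2 n)).
Proof.
move=> a ma; have [k ak] := rI1 ma; have [l al] := rI2 ma.
by exists (k + l * n)%N; rewrite exprD exprM; apply: mulI_in => //; apply: expI_in.
Qed.

Lemma finlen_mulI_expI J n : is_ideal J -> mulI I1 (expI I2 n) `<=` J ->
  @finlen R R^o setT J.
Proof.
move=> idJ sJ; apply: (finlen_primary hN hL) => // a /(radical_mulI_expI n).
exact: radicalS.
Qed.

Definition hilbz (n : int) : int := (lenI setT (mulI I1 (expIz I2 n)))%:Z.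

Variables (d : nat) (x : 'I_d -> R).
Hypothesis xI2 : forall j, I2 (x j).
Hypothesis regx : forall (k : 'I_d) a, prefix_ideal x k (x k * a) -> prefix_ideal x k a.

Lemma mulI_expIS a n : I2 a ->
  mulI I1 (expI I2 n) `<=` [set b | mulI I1 (expI I2 n.+1) (b * a)].
Proof.
move=> aI2; apply: mulI_min; first exact/colonI_ideal/mulI_ideal.
move=> u v uI1 vI2; rewrite /= -mulrA; apply: mulI_in => //.
by rewrite mulrC; apply: mulI_in.
Qed.

Definition prefix_len (k n : nat) : nat :=
  lenI setT (addI (prefix_ideal x k) (mulI I1 (expI I2 n))).

(** Multiplication by x_k maps R / (Q + I1 I2^n) to R / (Q + I1 I2^(n+1)), with cokernel R / (Q +
    x_k R + I1 I2^(n+1)); it is injective for large n by [superficial_colon]. *)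
Lemma prefix_lenS (k : 'I_d) :
  superficial (qpi (prefix_ideal x k) @` I2) (qpi (prefix_ideal x k) @` I1)
    (qpi (prefix_ideal x k) (x k)) ->
  exists N, forall n, (N <= n)%N ->
    prefix_len k n.+1 = (prefix_len k.+1 n.+1 + prefix_len k n)%N.
Proof.
set Q := prefix_ideal x k => sup.
have idQ : is_ideal Q by apply: prefix_ideal_ideal.
have [N colN] := superficial_colon idQ idI1 (@regx k) sup.
exists N => n le_n; rewrite /prefix_len -/Q.
set J := mulI I1 (expI I2 n); set J' := mulI I1 (expI I2 n.+1).
have idJ : is_ideal J by apply: mulI_ideal.
have idJ' : is_ideal J' by apply: mulI_ideal.
have idQJ' : is_ideal (addI Q J') by apply: addI_ideal.
pose C := @addS R R^o (@mulr_by R (x k) @` setT) (addI Q J').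
have idC : is_ideal C.
  by apply: addI_ideal => //; apply: (@submod_image R R^o R^o); apply: idealT.
have eC : C = addI (prefix_ideal x k.+1) J'.
  apply/seteqP; split=> v; rewrite /C.
    case/addSP=> _ [_ [[r _ <-] /addIP[q [j [qQ jJ ->]]] ->]].
    apply/addIP; exists (q + x k * r), j; split=> //.
      by apply/prefix_idealS; exists q, r.
    by rewrite /mulr_by; ring.
  case/addIP=> _ [j [/prefix_idealS[q [r [qQ ->]]] jJ ->]].
  apply/addSP; exists (mulr_by (x k) r), (q + j); split; first by exists r.
    by apply/addIP; exists q, j.
  by rewrite /mulr_by; ring.
have QC : addI Q J' `<=` C by apply: sub_addIr; apply: (@submod_image R R^o R^o);
  apply: idealT.
rewrite /lenI (@mlengthD _ _ _ _ C) //; last first.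
  by apply: (@finlen_mulI_expI _ n.+1) => //; apply: sub_addIr.
rewrite eC; congr (_ + _)%N; rewrite -eC /C -mlength_transfer //; last exact: idealT.
rewrite setTI; congr mlength; apply/seteqP; split=> a.
  by rewrite /preimage /= /mulr_by mulrC; apply: colN.
case/addIP=> q [j [qQ jJ ->]]; rewrite /preimage /= /mulr_by mulrDl.
apply/addIP; exists (q * x k), (j * x k); split=> //; first exact: (ideal_mulr _ idQ qQ).
exact: (mulI_expIS (xI2 k) jJ).
Qed.

Lemma prefix_len_diffz : superficial_seq I2 I1 x ->
  forall k, (k <= d)%N -> exists N, forall n : nat, (N <= n)%N ->
    (prefix_len k n)%:Z = iter k diffz hilbz n%:Z.
Proof.
case=> _ sup; elim=> [_|k IHk kd].
  exists 0%N => n _ /=; rewrite /prefix_len /hilbz /=; congr (Posz (lenI _ _)).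
  apply/seteqP; split; last by apply: sub_addIr; apply: prefix_ideal_ideal.
  apply: addI_min => //; first exact: mulI_ideal.
  by move=> v /prefix_ideal0->; apply: ideal0; apply: mulI_ideal.
have [N NP] := IHk (ltnW kd); have [N' N'P] := @prefix_lenS (Ordinal kd) (sup _).
exists (maxn N N').+1 => -[//|n]; rewrite ltnS geq_max => /andP[Nn N'n].
rewrite iterS /diffz -NP ?leqW // [n.+1%:Z - 1](_ : _ = n%:Z) -?NP //; last first.
  by rewrite intS addrC addKr.
by rewrite (N'P n) //= PoszD addrK.
Qed.

(** The reduction equation puts I2^(N+1) inside the ideal generated by x, which then absorbs I1 I2^n
    for n > N. *)
Lemma prefix_len_large : is_reduction (ideal_gen (range x)) I2 ->
  exists N, forall n, (N <= n)%N -> prefix_len d n = lenI setT (ideal_gen (range x)).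
Proof.
case=> idX _ [N red]; exists N.+1 => n Nn; rewrite /prefix_len prefix_idealE.
congr (lenI _ _); apply/seteqP; split; last by apply: sub_addIl; apply: mulI_ideal.
apply: addI_min => // a aJ.
have : expI I2 N.+1 a by apply: (expI_le Nn); move: aJ; apply: mulI_subr; apply: expI_ideal.
by rewrite red; apply: mulI_subl.
Qed.

End HilbertFunction.

(** * The complex C(1, n) *)

Section KoszulBasis.
Variables (R : comPzRingType) (d : nat) (x : 'I_d -> R).

Definition kext i (c : {ffun kbasis d i -> R^o}) (S : {set 'I_d}) : R :=
  oapp c 0 (insub S).

Definition krestrict i (c : {set 'I_d} -> R) : {ffun kbasis d i -> R^o} :=
  [ffun S => c (val S)].

Lemma kext_val i c (S : kbasis d i) : kext c (val S) = c S.
Proof. by rewrite /kext valK. Qed.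

Lemma kext_restrict i c (S : {set 'I_d}) : #|S| = i -> kext (krestrict i c) S = c S.
Proof. by move=> /eqP cS; rewrite /kext insubT /= ffunE. Qed.

Lemma kdiff_eq i c b (T : {set 'I_d}) : (forall S : {set 'I_d}, #|S| = i.+1 -> c S = b S) ->
  #|T| = i -> kdiff x c T = kdiff x b T.
Proof.
move=> e cT; apply: eq_bigr => j jT; rewrite e //.
by rewrite cardsU1 jT cT.
Qed.

(* Retyping of koszul_diff: only R^o carries the module structure over R. *)
Definition koszul_map i (c : {ffun kbasis d i -> R^o}) : {ffun kbasis d i.-1 -> R^o} :=
  koszul_diff x c.

(** For fixed j, the only S containing j with S minus j equal to T is T with j added, and j must lie
    outside T. *)
Lemma koszul_mapE i c T : koszul_map c T = kdiff x (@kext i c) (val T).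
Proof.
rewrite /koszul_map ffunE (exchange_big_dep predT) //= /kdiff [RHS]big_mkcond.
apply: eq_bigr => j _; case: ifP => [jT|/negbFE jT]; last first.
  rewrite big_pred0 // => S; apply/negbTE/andP => -[jS /eqP e].
  by move: jT; rewrite -e !inE eqxx.
rewrite /kext; case: insubP => [S _ eS|nS] /=; last first.
  rewrite mulr0 big_pred0 // => S; apply/negbTE/andP => -[jS /eqP e].
  by case/negP: nS; rewrite -e finset.setD1K //; apply: (valP S).
rewrite (big_pred1 S) => [|S'] /=.
  rewrite /ksign eS; congr (_ * _ * _); congr (_ ^+ _); apply: eq_card => k.
  by rewrite !inE andb_orl; case: eqP => // ->; rewrite ltnn (negbTE jT).
apply/andP/eqP => [[jS' /eqP e]|->]; last by rewrite eS !inE eqxx finset.setU1K.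
by apply: val_inj; rewrite eS -e finset.setD1K.
Qed.

(** As [0.-1] is 0, the target is degree 0 again; the empty set has no element to remove. *)
Lemma koszul_map0 (c : {ffun kbasis d 0 -> R^o}) : koszul_map c = 0.
Proof.
apply/ffunP => T; rewrite koszul_mapE ffunE /kdiff big1 // => j _.
rewrite /kext insubF ?mulr0 // cardsU1.
by move: (valP T); rewrite cards_eq0 => /eqP->; rewrite inE cards0.
Qed.

Lemma koszul_map_linear i : linear (@koszul_map i).
Proof.
move=> a c b; apply/ffunP => T; rewrite [RHS]ffunE [X in _ = X + _]ffunE !koszul_mapE.
rewrite /GRing.scale /= -kdiff_lin; congr kdiff; apply/funext => S.
rewrite /kext; case: insubP => [S' _ _|_] /=; first by rewrite !ffunE.
by rewrite mulr0 addr0.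
Qed.

HB.instance Definition _ i := GRing.isLinear.Build R
  {ffun kbasis d i -> R^o} {ffun kbasis d i.-1 -> R^o} _ (@koszul_map i)
  (@koszul_map_linear i).

Lemma koszul_map_map i (c : {ffun kbasis d i.+1 -> R^o}) :
  koszul_map (koszul_map c) = 0.
Proof.
case: i c => [|i] c; first exact: koszul_map0.
apply/ffunP => T; rewrite koszul_mapE ffunE -(kdiff_kdiff x (kext c) (val T)).
apply: (@kdiff_eq i) => [S cS|]; last by apply/eqP/(valP T).
have cS' : #|S| == i.+1 by apply/eqP.
by rewrite -[S](SubK (kbasis d i.+1) cS') kext_val (koszul_mapE c).
Qed.

Lemma card_kbasis i : #|{: kbasis d i}| = 'C(d, i).
Proof.
transitivity #|[set S : {set 'I_d} | #|S| == i]%SET|; last by rewrite card_draws card_ord.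
by rewrite card_sig; apply: eq_card => S; rewrite !inE.
Qed.

Definition kbasis0 : kbasis d 0 := exist _ finset.set0 (introT eqP (cards0 'I_d)).

Lemma kbasis0_eq (S : kbasis d 0) : S = kbasis0.
Proof. by apply: val_inj => /=; apply/eqP; rewrite -cards_eq0; apply: (valP S). Qed.

Lemma kdiff_set0 (c : {set 'I_d} -> R) : kdiff x c finset.set0 = \sum_j x j * c [set j]%SET.
Proof.
apply: eq_big => j; rewrite ?inE // => _; rewrite finset.setU0 /ksign.
rewrite (_ : [set k in _ | _]%SET = finset.set0) ?cards0 ?mul1r //.
by apply/setP => k; rewrite !inE.
Qed.

End KoszulBasis.

(** * Homology of C(1, n) computed in free modules *)

Section QuotientKoszul.
Local Open Scope quotient_scope.
Variables (R : comPzRingType) (d : nat) (x : 'I_d -> R) (I1 I2 : set R).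
Hypothesis xI2 : forall j, I2 (x j).

Local Notation V i := {ffun kbasis d i -> R^o}.
Local Notation J := (cpx_ideal I1 I2).

Lemma cpx_ideal_ideal n : is_ideal (J n).
Proof. exact: mulI_ideal. Qed.

(** For n <= 0 both ideals are the product of I1 with R. *)
Lemma cpx_ideal_mul n j : J (n - 1) `<=` [set a | J n (x j * a)].
Proof.
case: n => [[|n]|n].
- by move=> a aJ; apply: (ideal_mull _ (mulI_ideal I1 setT)).
- rewrite (_ : n.+1%:Z - 1 = n%:Z); last by rewrite intS addrC addKr.
  by move=> a aJ; rewrite /= mulrC; apply: (mulI_expIS (xI2 j) aJ).
- rewrite NegzE -opprD (_ : n.+1%:Z + 1 = n.+2%:Z); last by rewrite addrC -intS.
  by move=> a aJ; apply: (ideal_mull _ (mulI_ideal I1 setT)).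
Qed.

(** The kernel of the projection of the free module onto term i of C(1, n). The next two definitions
    are the preimages of the cycles and of the boundaries. *)
Definition cpx_sub (n : int) i : set (V i) := [set c | forall S, J (n - i%:Z) (c S)].
Arguments cpx_sub : clear implicits.
Definition cpx_cycles (n : int) i : set (V i) := @koszul_map R d x i @^-1` cpx_sub n i.-1.
Arguments cpx_cycles : clear implicits.
Definition cpx_bounds (n : int) i : set (V i) :=
  addS (@koszul_map R d x i.+1 @` setT) (cpx_sub n i).
Arguments cpx_bounds : clear implicits.

Lemma submod_cpx_sub n i : is_submod (cpx_sub n i).
Proof.
apply/submodP; split=> [S|a u v uJ vJ S]; rewrite !ffunE;
  first exact: (ideal0 (cpx_ideal_ideal _)).
by apply: (submodZD _ (cpx_ideal_ideal _)).
Qed.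

Lemma submod_cpx_cycles n i : is_submod (cpx_cycles n i).
Proof.
exact: (@submod_preimage R (V i) (V i.-1) (@koszul_map R d x i) _ (submod_cpx_sub n i.-1)).
Qed.

Lemma submod_koszul_range i : is_submod (range (@koszul_map R d x i)).
Proof. exact: (@submod_image R (V i) (V i.-1) (@koszul_map R d x i) _ (@submodT _ _)). Qed.

Lemma submod_cpx_bounds n i : is_submod (cpx_bounds n i).
Proof.
apply: submod_addS; last exact: submod_cpx_sub.
by apply: (submod_koszul_range i.+1).
Qed.

Lemma koszul_map_cpx_sub n i : cpx_sub n i `<=` cpx_cycles n i.
Proof.
case: i => [|i] c cJ S; first by rewrite koszul_map0 ffunE;
  exact: (ideal0 (cpx_ideal_ideal _)).
rewrite koszul_mapE; apply: ideal_sum => [|j _]; first exact: cpx_ideal_ideal.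
rewrite -mulrA; apply: (ideal_mull _ (cpx_ideal_ideal _)).
apply: cpx_ideal_mul; rewrite /kext; case: insubP => [S' _ _|_] /=;
  last exact: (ideal0 (cpx_ideal_ideal _)).
by have := cJ S'; rewrite intS opprD addrA addrAC.
Qed.

Lemma cpx_bounds_cycles n i : cpx_bounds n i `<=` cpx_cycles n i.
Proof.
apply: (addS_min (submod_cpx_cycles n i)); last exact: koszul_map_cpx_sub.
move=> _ [c _ <-] S; rewrite koszul_map_map ffunE.
exact: (ideal0 (cpx_ideal_ideal _)).
Qed.

Definition cpx_pi (n : int) i (c : V i) : cpx_term d I1 I2 n i :=
  [ffun S => \pi_(qmod (J (n - i%:Z))) (c S)].

Lemma cpx_pi_linear n i : linear (@cpx_pi n i).
Proof.
move=> a u v; apply/ffunP => S; rewrite !ffunE raddfD; congr (_ + _).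
by rewrite /GRing.scale /= pi_qscale.
Qed.

HB.instance Definition _ n i :=
  GRing.isLinear.Build R (V i) (cpx_term d I1 I2 n i) _ (@cpx_pi n i) (@cpx_pi_linear n i).

Lemma cpx_pi_eq n i (c b : V i) : cpx_pi n c = cpx_pi n b <-> cpx_sub n i (c - b).
Proof.
have eJ : mspan (J (n - i%:Z)) = J (n - i%:Z) by apply/mspan_id/cpx_ideal_ideal.
split=> [/ffunP e S|e].
  by have := e S; rewrite !ffunE => /qmod_eqP/set_mem; rewrite eJ.
apply/ffunP => S; rewrite !ffunE; apply/qmod_eqP/mem_set; rewrite eJ.
by have := e S; rewrite !ffunE.
Qed.

Definition cpx_repr n i (c : cpx_term d I1 I2 n i) : V i := [ffun S => repr (c S)].

Lemma cpx_reprK n i : cancel (@cpx_repr n i) (@cpx_pi n i).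
Proof. by move=> c; apply/ffunP => S; rewrite !ffunE reprK. Qed.

Lemma cpx_diff_pi n i (c : V i) :
  cpx_diff x (cpx_pi n c) = cpx_pi n (koszul_map x c).
Proof.
transitivity (cpx_pi n (koszul_map x (cpx_repr (cpx_pi n c)))).
  by apply/ffunP => S; rewrite [LHS]ffunE [RHS]ffunE.
apply/cpx_pi_eq; rewrite -linearB; apply: koszul_map_cpx_sub.
by apply/cpx_pi_eq; rewrite cpx_reprK.
Qed.

(** The projection is onto and its kernel lies in [cpx_bounds], so passing to preimages preserves
    the length. *)
Lemma cpx_hE n i : cpx_h x I1 I2 n i = mlength (cpx_cycles n i) (cpx_bounds n i).
Proof.
have eZ : [set c : cpx_term d I1 I2 n i | cpx_diff x c = 0] = @cpx_pi n i @` cpx_cycles n i.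
  have E c : cpx_diff x (cpx_pi n c) = 0 <-> cpx_cycles n i c.
    rewrite cpx_diff_pi -(linear0 (@cpx_pi n i.-1)).
    by rewrite cpx_pi_eq subr0.
  apply/seteqP; split=> [c c0|_ [c cZ <-]]; last exact/E.
  by exists (cpx_repr c); [apply/E|]; rewrite cpx_reprK.
have eB : range (@cpx_diff R d x I1 I2 n i.+1) = @cpx_pi n i @` cpx_bounds n i.
  apply/seteqP; split=> [_ [c _ <-]|_ [_ [_ [c _ <-] [l lL <-]] <-]].
    exists (koszul_map x (cpx_repr c)); last by rewrite -[in RHS](cpx_reprK c);
      exact: (esym (cpx_diff_pi n (i:=i.+1) _)).
    by apply: sub_addSl; [apply: submod_cpx_sub | exists (cpx_repr c)].
  exists (cpx_pi n c) => //; apply: etrans (cpx_diff_pi n (i:=i.+1) _) _; apply/cpx_pi_eq.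
  by rewrite opprD addrA subrr add0r; exact: (submodN (submod_cpx_sub n i) lL).
have sZ := submod_cpx_cycles n i; have sB := submod_cpx_bounds n i.
rewrite /cpx_h eZ eB.
have sub : cpx_pi (i:=i) n @` cpx_bounds n i `<=` cpx_pi (i:=i) n @` cpx_cycles n i.
  by move=> _ [c /cpx_bounds_cycles cZ <-]; exists c.
rewrite -[X in mlength X _ = _](addS_absorb _ _ sub); try exact: submod_image.
rewrite -mlength_transfer //; last exact: submod_image.
congr mlength; apply/seteqP; split=> [c [_ [b bB /cpx_pi_eq bc]]|c cB]; last first.
  by split; [apply: cpx_bounds_cycles | exists c].
rewrite -[c](subKr b); apply: submodB => //; apply: sub_addSr bc.
by apply: (submod_koszul_range i.+1).
Qed.

(** In degree 0 everything is a cycle, and the boundaries are the preimage of X + I1 I2^n under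
    evaluation at the empty set. *)
Lemma cpx_h0 n : cpx_h x I1 I2 n 0 = lenI setT (addI (ideal_gen (range x)) (J n)).
Proof.
rewrite cpx_hE; set X := ideal_gen _.
have idXJ : is_ideal (addI X (J n)) by apply: addI_ideal;
  [apply: ideal_gen_ideal | apply: cpx_ideal_ideal].
have -> : cpx_cycles n 0 = setT.
  by apply/seteqP; split=> // c _ S; rewrite koszul_map0 ffunE;
    exact: (ideal0 (cpx_ideal_ideal _)).
have -> : cpx_bounds n 0 = setT `&` @ffun_eval R R^o (kbasis d 0) (kbasis0 d) @^-1`
  addI X (J n).
  rewrite setTI; apply/seteqP; split=> [_ [_ [b _ <-] [l lL <-]]|c].
    apply/addIP; exists (koszul_map x b (kbasis0 d)), (l (kbasis0 d)).
    split; last by rewrite /ffun_eval ffunE.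
      rewrite koszul_mapE kdiff_set0; apply/range_genP.
      by exists (fun j => kext b [set j]%SET).
    by have := lL (kbasis0 d); rewrite subr0.
  case/addIP=> _ [j [/range_genP[a ->] jJ e]].
  apply/addSP; pose b := krestrict 1 (fun S => \sum_(j in S) a j).
  exists (koszul_map x b), (c - koszul_map x b); split; first by exists b.
    move=> S; rewrite subr0 ffunE [X in _ + X]ffunE (kbasis0_eq S) -[c _]/(ffun_eval _ c) e.
    rewrite (koszul_mapE x b) kdiff_set0.
    rewrite [X in _ - X](eq_bigr (fun j => x j * a j)) => [|k _];
      last by rewrite /b kext_restrict ?cards1 ?big_set1.
    by rewrite addrC addKr.
  by rewrite addrC subrK.
rewrite mlength_transfer //; last exact: submodT.
congr mlength; apply/seteqP; split=> // a _; apply: sub_addSl => //.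
by exists [ffun=> a] => //; rewrite /= /ffun_eval ffunE.
Qed.

(** The differential f carries the cycles onto X cap I1 I2^(n+1), and a cycle is a boundary exactly
    when f sends it into X I1 I2^n. *)
Lemma cpx_h1 (n : nat) : kexact x [set 0] 0 ->
  cpx_h x I1 I2 n.+1%:Z 1 =
  lenI (ideal_gen (range x) `&` mulI I1 (expI I2 n.+1))
       (mulI (ideal_gen (range x)) (mulI I1 (expI I2 n))).
Proof.
move=> ex; rewrite cpx_hE; set X := ideal_gen _; set Jn := mulI I1 (expI I2 n).
set Jn' := mulI I1 (expI I2 n.+1).
have e1 : n.+1%:Z - 1%:Z = n%:Z by rewrite intS addrC addKr.
have idJ : is_ideal Jn by apply: mulI_ideal.
have idX : is_ideal X by apply: ideal_gen_ideal.
have idXJ : is_ideal (mulI X Jn) by apply: mulI_ideal.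
pose f : {linear V 1 -> R^o} :=
  @ffun_eval R R^o (kbasis d 0) (kbasis0 d) \o koszul_map x (i := 1).
have fE c : f c = \sum_j x j * kext c [set j]%SET by rewrite -kdiff_set0;
  exact: (koszul_mapE x c (kbasis0 d)).
have f0 (b : V 2) : f (koszul_map x b) = 0 by rewrite /f /= koszul_map_map linear0.
have Z1 c : cpx_cycles n.+1%:Z 1 c <-> Jn' (f c).
  split=> [/(_ (kbasis0 d))|cJ S]; first by rewrite subr0.
  by rewrite (kbasis0_eq S) subr0.
have XJ : mulI X Jn `<=` X `&` Jn'.
  move=> v vXJ; split; first by move: vXJ; apply: mulI_subl.
  move: v vXJ => v /(mulI_rangeP _ _ idJ)[a aJ ->].
  apply: ideal_sum => [|j _]; first exact: mulI_ideal.
  by rewrite mulrC; apply: (mulI_expIS (xI2 j) (aJ j)).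
have fb (a : 'I_d -> R) : f (krestrict 1 (fun S => \sum_(j in S) a j)) = \sum_j x j * a j.
  by rewrite fE; apply: eq_bigr => j _; rewrite kext_restrict ?cards1 ?big_set1.
have -> : cpx_bounds n.+1%:Z 1 = cpx_cycles n.+1%:Z 1 `&` f @^-1` mulI X Jn.
  apply/seteqP; split=> [c cB|c [cZ /(mulI_rangeP _ _ idJ)[a aJ e]]].
    split; first exact: cpx_bounds_cycles.
    case: cB => _ [b _ <-] [l lL <-].
    suff : mulI X Jn (f (koszul_map x b + l)) by [].
    rewrite linearD f0 add0r fE; apply/mulI_rangeP => //.
    exists (fun j => kext l [set j]%SET) => // j; rewrite /kext.
    case: insubP => [S _ _|_] /=; last exact: ideal0.
    by have := lL S; rewrite e1.
  (* a' has entries in I1 I2^n and the same image as c, so c - a' is a cycle over R, hence a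
     boundary over R. *)
  pose a' := krestrict 1 (fun S => \sum_(j in S) a j).
  have [T /eqP|b bP] := ex (kext (c - a')).
    by rewrite cards_eq0 => /eqP->; rewrite kdiff_set0 -fE linearB [f c]e fb subrr.
  apply/addSP; exists (koszul_map x (krestrict 2 b)), a'; split.
  - by exists (krestrict 2 b).
  - move=> S; rewrite e1 ffunE; case: S => S /= /cards1P[j ->]; rewrite big_set1; exact: aJ.
  apply/eqP; rewrite -subr_eq; apply/eqP/ffunP => S.
  rewrite -[LHS](kext_val (c - a')) koszul_mapE.
  have cS : #|val S| = 1%N by apply/eqP/(valP S).
  rewrite (subr0_eq (bP _ cS)); apply: (@kdiff_eq _ _ _ 1) => // S' cS'.
  by rewrite kext_restrict.
rewrite mlength_transfer //; last exact: submod_cpx_cycles.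
congr mlength; apply/seteqP; split.
  apply: addS_min => //; first exact: (setI_ideal idX (mulI_ideal I1 (expI I2 n.+1))).
  move=> _ [c /Z1 cJ <-]; split=> //; rewrite fE; apply/range_genP.
  by exists (fun j => kext c [set j]%SET).
move=> v [/range_genP[a ->] vJ]; apply: sub_addSl => //.
exists (krestrict 1 (fun S => \sum_(j in S) a j)); last exact: fb.
by apply/Z1; rewrite fb.
Qed.

Hypothesis finJ : forall n : int, @finlen R R^o setT (J n).

Lemma is_length_cpx_sub n i : is_length setT (cpx_sub n i) ('C(d, i) * lenI setT (J (n
  - i%:Z))).
Proof.
by rewrite -card_kbasis; apply: is_length_ffun; apply/finlenP.
Qed.

(** With V, Z, B, L the free module, [cpx_cycles], [cpx_bounds] and [cpx_sub], V / L has layers V /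
    Z, Z / B and B / L; the last is isomorphic to V / Z in degree i + 1, so the alternating sum
    telescopes. *)
Lemma cpx_euler n : \sum_(i < d.+1) (-1) ^+ i * ('C(d, i) * lenI setT (J (n - i%:Z)))%N%:Z
  = \sum_(i < d.+1) (-1) ^+ i * (cpx_h x I1 I2 n i)%:Z.
Proof.
pose w i : int := (mlength setT (cpx_cycles n i))%:Z.
have wE i : ('C(d, i) * lenI setT (J (n - i%:Z)))%N%:Z = w i + (cpx_h x I1 I2 n i)%:Z +
  w i.+1.
  have fin : finlen setT (cpx_sub n i) by exists ('C(d, i) * lenI setT (J (n - i%:Z)))%N;
    apply: is_length_cpx_sub.
  have sL := submod_cpx_sub n i; have sZ := submod_cpx_cycles n i.
  have sB := submod_cpx_bounds n i.
  have LB : cpx_sub n i `<=` cpx_bounds n i.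
    by apply: sub_addSr; apply: (submod_koszul_range i.+1).
  have BZ := @cpx_bounds_cycles n i.
  rewrite -(mlengthE (is_length_cpx_sub n i)) (mlengthD fin sZ) //;
    last exact: koszul_map_cpx_sub.
  rewrite PoszD -addrA; congr (_ + _).
  rewrite (mlengthD _ sB) //; last by apply: (finlenr fin) => //; apply: koszul_map_cpx_sub.
  rewrite PoszD cpx_hE; congr (_ + Posz _).
  rewrite /cpx_bounds -(@mlength_transfer R (V i.+1) (V i) (@koszul_map R d x i.+1)) //;
    last exact: submodT.
  by rewrite setTI.
have w0 : w 0%N = 0.
  rewrite /w (_ : cpx_cycles n 0 = setT);
    first by rewrite (mlengthE (is_length_refl (submodT _))).
  by apply/seteqP; split=> // c _ S; rewrite koszul_map0 ffunE;
    exact: (ideal0 (cpx_ideal_ideal _)).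
(* No subset has d + 1 elements, so the end term of the telescope vanishes. *)
have wd : w d.+1 = 0.
  rewrite /w (_ : cpx_cycles n d.+1 = setT);
    first by rewrite (mlengthE (is_length_refl (submodT _))).
  apply/seteqP; split=> // c _; rewrite (_ : c = 0);
    first exact: (submod0 (submod_cpx_cycles _ _)).
  apply/ffunP => -[S /= cS]; have := max_card (mem S).
  by rewrite (eqP cS) card_ord ltnn.
under eq_bigr do rewrite wE.
suff E k : \sum_(i < k) (-1) ^+ i * (w i + (cpx_h x I1 I2 n i)%:Z + w i.+1) =
    \sum_(i < k) (-1) ^+ i * (cpx_h x I1 I2 n i)%:Z - (-1) ^+ k * w k.
  by rewrite E wd mulr0 subr0.
elim: k => [|k IHk]; first by rewrite !big_ord0 w0 mulr0 subr0.
by rewrite !big_ord_recr /= IHk exprS; ring.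
Qed.

End QuotientKoszul.

(** * Iterated differences *)

Section Differences.
Implicit Types (f u w : int -> int).

Lemma subz1S (n : nat) : n.+1%:Z - 1 = n%:Z.
Proof. by rewrite intS addrC addKr. Qed.

Lemma iter_diffzB e f u n :
  iter e diffz (fun k => f k - u k) n = iter e diffz f n - iter e diffz u n.
Proof. by elim: e n => // e IHe n; rewrite !iterS /diffz !IHe; ring. Qed.

Lemma iter_diffz_eventually0 e N f : (forall n : nat, (N <= n)%N -> f n%:Z = 0) ->
  forall n : nat, (N + e <= n)%N -> iter e diffz f n%:Z = 0.
Proof.
move=> f0; elim: e => [|e IHe] n; first by rewrite addn0; apply: f0.
case: n => [|n]; rewrite addnS ?ltn0 // ltnS => le_n.
by rewrite iterS /diffz subz1S !IHe ?subrr ?leqW.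
Qed.

(** Backward differences at 0 see only arguments n <= 0. *)
Lemma iter_diffz_const e c f : (forall p : nat, f (- p%:Z) = c) ->
  iter e diffz f 0 = if e == 0%N then c else 0.
Proof.
move=> fc; have E p : iter e diffz f (- p%:Z) = if e == 0%N then c else 0.
  elim: e p => [|e IHe] p //=.
  by rewrite /diffz -opprD [_ + 1](_ : _ = p.+1%:Z) ?IHe ?subrr // addrC -intS.
by have := E 0%N; rewrite oppr0.
Qed.

Lemma iter_diffzE e f n :
  iter e diffz f n = \sum_(i < e.+1) (-1) ^+ i * ('C(e, i)%:Z * f (n - i%:Z)).
Proof.
elim: e n => [|e IHe] n; first by rewrite big_ord_recl big_ord0 /= mul1r mul1r subr0 addr0.
rewrite iterS /diffz !IHe [RHS]big_ord_recl [in LHS]big_ord_recl /=.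
rewrite -addrA; congr (_ + _); first by rewrite !bin0.
rewrite [X in _ = X](_ : _ =
    \sum_(i < e.+1) (-1) ^+ i.+1 * ('C(e, i.+1)%:Z * f (n - i.+1%:Z))
    - \sum_(i < e.+1) (-1) ^+ i * ('C(e, i)%:Z * f (n - 1 - i%:Z))); last first.
  rewrite -sumrB; apply: eq_bigr => i _; rewrite /bump /= add1n binS PoszD exprS.
  by rewrite -addrA -opprD -intS; ring.
congr (_ - _); rewrite [RHS]big_ord_recr /= bin_small // mul0r mulr0 addr0.
by apply: eq_bigr.
Qed.

Lemma abel_sum (a w : nat -> int) M :
  \sum_(0 <= n < M) a n * (w n.+1 - w n) =
  a M * w M - a 0%N * w 0%N - \sum_(0 <= n < M) (a n.+1 - a n) * w n.+1.
Proof.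
elim: M => [|M IHM]; first by rewrite !big_nil; ring.
by rewrite !big_nat_recr //= IHM; ring.
Qed.

(** Summation by parts and Pascal's rule lower k; the boundary term at M vanishes with the
    differences of u, the one at 0 because C(0, k+1) = 0. *)
Lemma binomial_diffz_sum k N u M : (forall n : nat, (N <= n)%N -> u n%:Z = 0) ->
  (N + k <= M)%N ->
  \sum_(0 <= n < M) 'C(n, k)%:Z * iter k.+1 diffz u n.+1%:Z = (-1) ^+ k.+1 * u 0.
Proof.
move=> u0; elim: k => [|k IHk] le_M; under eq_bigr do rewrite iterS /diffz subz1S.
  under eq_bigr do rewrite bin0 mul1r.
  by rewrite telescope_sumr //= u0 ?expr1; [ring | rewrite addn0 in le_M].
rewrite (abel_sum (fun n => 'C(n, k.+1)%:Z) (fun n => iter k.+1 diffz u n%:Z)).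
rewrite (iter_diffz_eventually0 u0) // mulr0 bin0n mul0r subrr sub0r exprS mulN1r mulNr.
rewrite -IHk; last by rewrite (leq_trans _ le_M) // addnS.
by congr (- _); apply: eq_bigr => n _; rewrite binS PoszD [_ + 'C(n, k)%:Z]addrC addrK.
Qed.

(* The polynomial C(n + k - 1, k) in n; at negative arguments this is the upper
   negation formula. *)
Definition binz (k : nat) (n : int) : int :=
  match n with
  | Posz p => 'C(p + k - 1, k)%:Z
  | Negz p => (-1) ^+ k * 'C(p.+1, k)%:Z
  end.

Lemma diffz_binz k n : diffz (binz k.+1) n = binz k n.
Proof.
rewrite /diffz; case: n => [[|p]|p].
- rewrite sub0r -[- 1]/(Negz 0) /= add0n subSS subn0 bin_small // add0n.
  case: k => [|k]; first by [].
  by rewrite !bin_small ?subn1 //; ring.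
- by rewrite subz1S /= addSn addnS !subSS !subn0 binS PoszD addrC addKr.
rewrite (_ : Negz p - 1 = Negz p.+1); last by rewrite !NegzE -opprD addrC -intS.
by rewrite /= [in 'C(p.+2, k.+1)]binS PoszD exprS; ring.
Qed.

Lemma binz0 n : binz 0 n = 1.
Proof. by case: n => n; rewrite /= bin0 ?mulr1. Qed.

Lemma binz_at0 k : binz k 0 = (k == 0%N)%:Z.
Proof. by case: k => [|k] //=; rewrite add0n subn1 /= bin_small. Qed.

#[local] Arguments binz : simpl never.

(** The degree q is a parameter because each difference drops the last coefficient and stays in this
    family. *)
Definition hilb_poly (g : nat -> int) (q : nat) (n : int) : int :=
  \sum_(j < q.+1) (-1) ^+ j * g j * binz (q - j) n.

Lemma iter_diffz_hilb_poly g e q n : iter e diffz (hilb_poly g (e + q)) n = hilb_poly g q n.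
Proof.
elim: e n => // e IHe n; rewrite iterSr -IHe; congr (iter e diffz _ n).
apply/funext => k;
  rewrite /diffz /hilb_poly addSn big_ord_recr /= [X in _ - X]big_ord_recr /=.
rewrite subnn !binz0 opprD addrACA subrr addr0 -sumrB; apply: eq_bigr => j _.
by rewrite -mulrBr subSn ?leq_ord // -(diffz_binz (e + q - j)).
Qed.

Lemma hilb_poly_at0 g q : hilb_poly g q 0 = (-1) ^+ q * g q.
Proof.
rewrite /hilb_poly big_ord_recr /= subnn binz0 mulr1 big1 ?add0r // => j _.
by rewrite binz_at0 subn_eq0 leqNgt ltn_ord mulr0.
Qed.

Lemma hilb_poly0 g n : hilb_poly g 0 n = g 0%N.
Proof.
by rewrite /hilb_poly big_ord_recl big_ord0 subnn binz0 mulr1 addr0 expr0 mul1r.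
Qed.

End Differences.

Section Ranks.
Variables (R : comPzRingType).
Implicit Types I J K : set R.

Lemma addIC I J : addI I J = addI J I.
Proof.
by apply/seteqP; split=> v /addIP[a [b [aI bJ ->]]]; apply/addIP; exists b, a;
  rewrite addrC.
Qed.

Lemma lenI_second_iso I J : is_ideal I -> is_ideal J ->
  lenI (addI I J) J = lenI I (I `&` J).
Proof.
move=> idI idJ; rewrite /lenI.
rewrite (_ : I `&` J = I `&` @idfun R^o @^-1` J) // (@mlength_transfer R R^o R^o idfun) //.
by rewrite image_id.
Qed.

End Ranks.

(** * The two formulas for the coefficients g_i *)

Theorem lemma5p4 (R : comNzRingType) (m : set R) (d : nat)
    (I1 I2 : set R) (x : 'I_d -> R) (g : nat -> int) (i : nat)
    (hCM : cohen_macaulay_local m)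
    (hdim : krull_dim R d)
    (hd : (1 <= d)%N)
    (hres : infinite_set [set: qring m])
    (hI1 : primary_to m I1)
    (hI2 : primary_to m I2)
    (hxred : is_minimal_reduction (ideal_gen (range x)) I2)
    (hxsup : superficial_seq I2 I1 x)
    (hg : hilbert_coeffs I1 I2 d g)
    (hi : (1 <= i <= d)%N) :
  let X : set R := ideal_gen (range x) in
  let h (j : nat) (n : int) : int := (cpx_h x I1 I2 n j)%:Z in
  let K : set R := if (i < d)%N then setT else I1 in
  (exists2 s : int,
     sums_to i.-1
       (fun n : nat => 'C(n, i.-1)%:Z *
          ((lenI (addI (mulI I1 (expI I2 n.+1)) X) X)%:Z
           - \sum_(1 <= j < d.+1) (-1) ^+ j * h j n.+1%:Z)) s
     & g i = s + (-1) ^+ d * (lenI setT K)%:Z)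
  /\
  (exists2 s : int,
     sums_to i.-1
       (fun n : nat => 'C(n, i.-1)%:Z *
          ((lenI (mulI I1 (expI I2 n.+1)) (mulI X (mulI I1 (expI I2 n))))%:Z
           - \sum_(2 <= j < d.+1) (-1) ^+ j * h j n.+1%:Z)) s
     & g i = s + (-1) ^+ d * (lenI setT K)%:Z).
Proof.
move=> X h K.
case: hCM => hN hL [k [hk [[y [my regy]] _]]].
(* The Krull dimension is unique, so the regular sequence y has length d. *)
have ek : k = d.
  case: hk hdim => [[p pP] pmax] [[q qP] qmax].
  by apply/eqP; rewrite eqn_leq (qmax _ _ pP) (pmax _ _ qP).
subst k.
case: hI1 => -[idI1 _ _] radI1; case: hI2 => -[idI2 _ _] radI2.
have rI1 : m `<=` radical I1 by rewrite radI1.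
have rI2 : m `<=` radical I2 by rewrite radI2.
case: (hxred) => redX _; have [idX XI2 [r er]] := redX.
have xI2 j : I2 (x j) by apply: XI2; apply: sub_ideal_gen; exists j.
have mx j : m (x j) by rewrite -radI2; exists 1%N; rewrite expr1.
have rX : m `<=` radical X.
  move=> a /rI2[n an]; exists (n * r.+1)%N; rewrite exprM.
  suff : expI I2 r.+1 `<=` X by apply; apply: expI_in.
  by rewrite er; apply: mulI_subl.
have exact_x e : kexact x [set 0] e.
  by apply: kexact_of_regular_seq regy _ => j; apply: rX.
have regx : forall (k : 'I_d) a, prefix_ideal x k (x k * a) -> prefix_ideal x k a.
  by move=> k a; apply: trivial_relations_regular hN hL mx _ _ _;
    apply: kexact_trivial_relations.
have finJ n : @finlen R R^o setT (cpx_ideal I1 I2 n).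
  have [e ->] : exists e, cpx_ideal I1 I2 n = mulI I1 (expI I2 e).
    by case: n => n; [exists n | exists 0%N].
  by apply: (finlen_mulI_expI hN hL rI1 rI2 (n := e)) => //; apply: mulI_ideal.
pose H := hilbz I1 I2.
(* Both brackets turn out to be [v] at n + 1. *)
pose v n : int := (lenI setT X)%:Z - \sum_(j < d.+1) (-1) ^+ j * h j n.
have dH n : iter d diffz H n = \sum_(j < d.+1) (-1) ^+ j * h j n.
  rewrite iter_diffzE -(cpx_euler xI2 finJ).
  by apply: eq_bigr => j _; rewrite PoszM.
case: hg => N0 hg.
pose F n := hilb_poly g d n - H n.
have F0 n : (N0 < n)%N -> F n%:Z = 0.
  move=> Nn; apply/eqP; rewrite subr_eq0 eq_sym; apply/eqP.
  rewrite /H /hilbz /= (hg _ (ltnW Nn)) big_mkord; apply: eq_bigr => j _.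
  by rewrite /= addnBA // -ltnS.
have dP e n : (e <= d)%N -> iter e diffz (hilb_poly g d) n = hilb_poly g (d - e) n.
  by move=> ed; rewrite -{1}(subnKC ed) iter_diffz_hilb_poly.
have g0 : g 0%N = (lenI setT X)%:Z.
  have [N1 E1] := prefix_len_diffz hN hL idI1 rI1 rI2 xI2 regx hxsup (leqnn d).
  have [N2 E2] := prefix_len_large I1 redX.
  (* Beyond all three thresholds; the summand d leaves room for the backward steps of D^d. *)
  pose n := (N0.+1 + d + N1 + N2)%N.
  have <- : iter d diffz (hilb_poly g d) n%:Z = g 0%N.
    by rewrite dP // subnn hilb_poly0.
  rewrite -(E2 n) ?leq_addl // E1; last by rewrite /n -addnA addnCA leq_addr.
  apply/eqP; rewrite -subr_eq0 -iter_diffzB; apply/eqP.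
  by apply: (iter_diffz_eventually0 F0); rewrite /n -addnA leq_addr.
have dF n : iter d diffz F n = v n.
  by rewrite iter_diffzB dH dP // subnn hilb_poly0 g0.
(* With J = I1 I2^(n+1), l((J + X) / X) = l(R / X) - l(R / (X + J)), and the last length is h_0. *)
have v1 (n : nat) : (lenI (addI (mulI I1 (expI I2 n.+1)) X) X)%:Z
     - \sum_(1 <= j < d.+1) (-1) ^+ j * h j n.+1%:Z = v n.+1%:Z.
  rewrite /v -(big_mkord predT (fun j => (-1) ^+ j * h j n.+1%:Z)) [X in _ = _ -
    X]big_ltn //.
  rewrite expr0 mul1r /h (cpx_h0 _ xI2) /cpx_ideal /=; set J := mulI I1 _.
  have idJ : is_ideal J by apply: mulI_ideal.
  have idXJ : is_ideal (addI X J) by apply: addI_ideal.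
  have finX : @finlen R R^o setT X by apply: (finlen_primary hN hL).
  rewrite opprD addrA; congr (_ - _); rewrite addIC /lenI.
  rewrite (mlengthD finX idXJ) //; last exact: sub_addIl.
  by rewrite PoszD addrC addKr.
(* Passing through X cap J splits J / X I1 I2^n into J / (X cap J), of the same length as (J + X) /
   X, and a part of length h_1. *)
have v2 (n : nat) : (lenI (mulI I1 (expI I2 n.+1)) (mulI X (mulI I1 (expI I2 n))))%:Z
     - \sum_(2 <= j < d.+1) (-1) ^+ j * h j n.+1%:Z = v n.+1%:Z.
  rewrite -v1 [in RHS]big_ltn // /h (cpx_h1 _ xI2 _ (exact_x 0%N)) expr1 mulN1r opprD
    opprK addrA.
  congr (_ - _); set J := mulI I1 _; set XJ := mulI X _.
  have idJ : is_ideal J by apply: mulI_ideal.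
  have idXJ : is_ideal XJ by apply: mulI_ideal.
  have XJX : XJ `<=` X by apply: mulI_subl.
  have XJJ : XJ `<=` J.
    apply: mulI_min => // a b aX bJ; rewrite mulrC.
    by apply: mulI_expIS bJ; apply: XI2.
  have finXJ : @finlen R R^o setT XJ.
    apply: (finlen_primary hN hL) => // a ma; have [e1 a1] := rX a ma.
    have [e2 a2] := radical_mulI_expI rI1 rI2 n ma.
    by exists (e1 + e2)%N; rewrite exprD; apply: mulI_in.
  rewrite lenI_second_iso // setIC -PoszD; congr Posz.
  have idXI : is_ideal (X `&` J) by apply: setI_ideal.
  apply: mlengthD => //; first by apply: (finlenr finXJ).
  by move=> a aXJ; split; [apply: XJX | apply: XJJ].
have [i0 id] : (0 < i)%N /\ (i <= d)%N by apply/andP.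
(* H is l(R / I1) for all n <= 0, so only the zeroth difference, i = d, survives; this is the origin
   of K. *)
have H0 : iter (d - i) diffz H 0 = (if (i < d)%N then 0 else (lenI setT I1)%:Z).
  rewrite (@iter_diffz_const _ (lenI setT I1)%:Z) ?subn_eq0; last first.
    by case=> [|p]; rewrite ?oppr0 -?NegzE /H /hilbz /= mulIT.
  by rewrite leqNgt if_neg.
have key : (-1) ^+ i * iter (d - i) diffz F 0 = g i - (-1) ^+ d * (lenI setT K)%:Z.
  rewrite iter_diffzB dP ?leq_subr // subKn // hilb_poly_at0 H0 mulrBr mulrA -expr2
    sqrr_sign mul1r.
  congr (_ - _); rewrite /K; case: ltnP => [_|di].
    by rewrite /lenI (mlengthE (is_length_refl (idealT R))) !mulr0.
  by rewrite (_ : i = d) //; apply/eqP; rewrite eqn_leq id di.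
pose s := (-1) ^+ i * iter (d - i) diffz F 0.
have sums f : (forall n : nat, f n = v n.+1%:Z) -> sums_to i.-1 (fun n => 'C(n,
  i.-1)%:Z * f n) s.
  move=> fE; exists (N0.+1 + d)%N; split=> [n Nn|].
    by rewrite fE -dF (iter_diffz_eventually0 F0) ?mulr0 // leqW.
  have uE n : (N0.+1 + (d - i) <= n)%N -> iter (d - i) diffz F n%:Z = 0.
    exact: iter_diffz_eventually0 F0 n.
  (* With u = D^(d-i) F and k = i - 1, the difference D^(k+1) u is D^d F. *)
  rewrite /s -{1}(prednK i0) -(binomial_diffz_sum (k := i.-1) (M := (N0.+1 + d)%N) uE);
    last first.
    by rewrite -addnA leq_add2l; rewrite -{2}(subnK id) leq_add2l leq_pred.
  (* The terms with n < i - 1 have a zero binomial, so the sum may start at 0. *)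
  rewrite (@big_cat_nat _ _ _ i.-1) //;
    last by rewrite (leq_trans (leq_pred i)) // (leq_trans id) // leq_addl.
  rewrite [X in X + _ = _]big_nat big1 ?add0r => [|n /andP[_ ni]];
    last by rewrite bin_small ?mul0r.
  by apply: eq_bigr => n _; rewrite prednK // -iterD subnKC // dF fE.
have gi : g i = s + (-1) ^+ d * (lenI setT K)%:Z by rewrite /s key subrK.
by split; exists s => //; [exact: (sums _ v1) | exact: (sums _ v2)].
Qed.
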